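(* Let $(E,\rho,[\cdot,\cdot]_E,L)$ be a regular local pre-Leibniz algebroid over $M$ with a locality projector $\mathcal{P}$, and let $(g,\nabla)$ be an $E$-Hessian structure. If $\nabla$ is admissible, then the triplet $(g,Q(\nabla,g),T(\nabla))$ is an $E$-statistical structure.
   Context: Everything is smooth; $M$ is an orientable, paracompact, Hausdorff smooth manifold, $E\to M$ a real vector bundle, $\mathfrak{X}(E)=\Gamma(E)$, $\Omega^1(E)=\Gamma(E^* )$. An anchored vector bundle $(E,\rho)$ is a vector bundle $E$ with a vector bundle morphism $\rho:E\to T(M)$ over the identity; it is regular if $\rho$ has locally constant rank. A linear $E$-connection is an $\mathbb{R}$-bilinear map $\nabla:\mathfrak{X}(E)\times\mathfrak{X}(E)\to\mathfrak{X}(E)$ with $\nabla_u(fv)=\rho(u)(f)v+f\nabla_u v$ and $\nabla_{fu}v=f\nabla_u v$. An $E$-metric is a symmetric non-degenerate section $g$ of $E^*\otimes E^*$; the $E$-non-metricity is $Q(\nabla,g)(u,v,w)=(\nabla g)(u,v,w)=\rho(u)(g(v,w))-g(\nabla_u v,w)-g(v,\nabla_u w)$. A local almost-Leibniz algebroid $(E,\rho,[\cdot,\cdot]_E,L)$ is an anchored vector bundle with an $\mathbb{R}$-bilinear bracket $[\cdot,\cdot]_E$ on $\mathfrak{X}(E)$ and a $C^\infty(M,\mathbb{R})$-multilinear map $L:\Omega^1(E)\times\mathfrak{X}(E)\times\mathfrak{X}(E)\to\mathfrak{X}(E)$ with $[u,fv]_E=\rho(u)(f)v+f[u,v]_E$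 and $[fu,v]_E=-\rho(v)(f)u+f[u,v]_E+L(Df,u,v)$, where $(Df)(u):=\rho(u)(f)$. It is a local pre-Leibniz algebroid if moreover $\rho([u,v]_E)=[\rho(u),\rho(v)]$. A locality projector is a $C^\infty(M,\mathbb{R})$-linear map $\mathcal{P}:\mathfrak{X}(E)\to\mathfrak{X}(E)$ such that the image of $\widehat{L}:=\mathcal{P}L$ lies in the kernel of $\rho$, and $\mathcal{P}$ restricted to the kernel of $\rho$ is the identity. Below, $(X_a)$ is any local frame of $E$ with dual coframe $(e^a)$, and repeated indices are summed. $\nabla$ is admissible if $[u,v]_E+[v,u]_E=L(e^a,\nabla_{X_a}u,v)+L(e^a,\nabla_{X_a}v,u)$ for all $u,v$. The modified bracket is $[u,v]_E^{\nabla}:=[u,v]_E-L(e^a,\nabla_{X_a}u,v)$ and the $E$-torsion is $T(\nabla)(u,v):=\nabla_u v-\nabla_v u-[u,v]_E^{\nabla}$. The projected modified bracket is $[u,v]_E^{\widehat{\nabla}}:=[u,v]_E-\widehat{L}(e^a,\nabla_{X_a}u,v)$ and the projected $E$-torsion is $\widehat{T}(\nabla)(u,v):=\nabla_u v-\nabla_v u-[u,v]_E^{\widehat{\nabla}}$; $\nabla$ is projected $E$-torsion-free if $\widehat{T}(\nabla)=0$. The $E$-curvature is $R(\nabla)(u,v)w:=\nabla_u\nabla_v w-\nabla_v\nabla_u w-\nabla_{[u,v]_E^{\widehat{\nabla}}}w$; $\nabla$ is $E$-flat if $R(\nabla)=0$. The $E$-Hessian of a function $f$ is $H(\nabla)(f)(u,v):=\rho(u)(\rho(v)(f))-Df(\nabla_u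 v)$. An $E$-Hessian structure is a pair $(g,\nabla)$ where $\nabla$ is an $E$-flat, projected $E$-torsion-free linear $E$-connection and $g$ is an $E$-metric that is locally (in a neighbourhood of each point) of the form $g=H(\nabla)(f)$ for some smooth function $f$. An $E$-statistical structure is a triplet $(g,C,B)$ with $g$ an $E$-metric, $C$ a totally symmetric $(0,3)$-type $E$-tensor (section of $E^*\otimes E^*\otimes E^*$), and $B:\mathfrak{X}(E)\times\mathfrak{X}(E)\to\mathfrak{X}(E)$ an anti-symmetric $C^\infty(M,\mathbb{R})$-bilinear map. *)

(* Defs.v *)
(* MathComp and MathComp-Analysis.

   Conventions.
   - Smooth objects are raw functions together with a smoothness predicate (as
     for [measurable_fun]): X(E) is [smooth_sect E], a set of functions
     [forall x, E x]; an operator "X(E) x X(E) -> X(E)" is a function on raw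
     sections that preserves smoothness, and all its laws are required on
     smooth arguments only.
   - Pointwise tensors (E-metrics, sections of tensor powers of the dual) are
     smooth families of multilinear forms on the fibres; maps that are
     C^oo(M)-multilinear on sections (L, P, B) are kept as maps of sections. *)
From HB Require Import structures.
From mathcomp Require Import all_boot all_order all_algebra.
From mathcomp Require Import all_classical all_reals all_analysis.
Set Implicit Arguments.
Unset Strict Implicit.
Unset Printing Implicit Defensive.
Import Order.TTheory GRing.Theory Num.Theory.
Import numFieldNormedType.Exports.
Local Open Scope classical_set_scope.
Local Open Scope ring_scope.

(** * Smooth manifolds *)

(* h is C^oo at the points of the open set V: every iterated partial derivative
   of h, of every order, is (Frechet) differentiable on V. *)
Definition smooth_in (R : realType) (n : nat) (V : set 'rV[R]_n)
    (h : 'rV[R]_n -> R) : Prop :=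
  forall (s : seq 'I_n) (y : 'rV[R]_n), V y ->
    differentiable (foldr (fun i k => 'D_(delta_mx 0 i) k) h s) y.

Record chart (R : realType) (n : nat) (M : topologicalType) := Chart {
  chart_fun :> M -> 'rV[R]_n;
  cdom : set M;
  cinv : 'rV[R]_n -> M;
  cdom_open : open cdom;
  cimg_open : open (chart_fun @` cdom);
  chart_cont : forall x, cdom x -> {for x, continuous chart_fun};
  cinv_cont : forall y, (chart_fun @` cdom) y -> {for y, continuous cinv};
  cinvK : forall x, cdom x -> cinv (chart_fun x) = x }.

Definition chart_compatible (R : realType) (n : nat) (M : topologicalType)
    (c d : chart R n M) : Prop :=
  forall i : 'I_n,
    smooth_in (c @` (cdom c `&` cdom d)) (fun y => d (cinv c y) 0 i) /\
    smooth_in (d @` (cdom c `&` cdom d)) (fun y => c (cinv d y) 0 i).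

(* A manifold comes with a preferred chart at each point; it only serves to
   represent the tangent space at that point by R^n. *)
Record manifold (R : realType) (n : nat) := Manifold {
  mspace :> topologicalType;
  atlas : set (chart R n mspace);
  atlas_compatible : forall c d, atlas c -> atlas d -> chart_compatible c d;
  chart_at : mspace -> chart R n mspace;
  chart_at_atlas : forall x, atlas (chart_at x);
  chart_at_dom : forall x, cdom (chart_at x) x }.

Definition paracompact (M : topologicalType) : Prop :=
  forall O : set (set M),
    (forall U, O U -> open U) -> (forall x, exists2 U, O U & U x) ->
    exists V : set (set M),
      [/\ forall W, V W -> open W,
          forall x, exists2 W, V W & W x,
          forall W, V W -> exists2 U, O U & W `<=` U
        & forall x : M, exists2 N, nbhs x N &
            finite_set [set W | V W /\ W `&` N !=set0]].

Definition orientable (R : realType) (n : nat) (M : manifold R n) : Prop :=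
  exists B : set (chart R n M),
    [/\ forall x, exists2 c, B c & cdom c x,
        forall c d, B c -> (@atlas R n M) d -> chart_compatible c d
      & forall c d, B c -> B d -> forall x, cdom c x -> cdom d x ->
          0 < \det (jacobian (fun y : 'rV[R]_n => d (cinv c y)) (c x))].

Section Manifold.
Context {R : realType} {n : nat} {M : manifold R n}.

Definition smooth_on (U : set M) (f : M -> R) : Prop :=
  forall c, atlas c -> smooth_in (c @` (U `&` cdom c)) (fun y => f (cinv c y)).

Definition smooth (f : M -> R) : Prop := smooth_on setT f.

(* T_x M, a vector being given by its components in [chart_at x] *)
Definition tangent (x : M) : vectType R := 'rV[R]_n.

(* the directional derivative v(f), for f : M -> R smooth near x *)
Definition tder (x : M) (v : tangent x) (f : M -> R) : R :=
  'D_(v : 'rV[R]_n) (fun y : 'rV[R]_n => f (cinv (chart_at x) y))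
     (chart_at x x).

(* Z = [X, Y] *)
Definition is_lie_bracket (X Y Z : forall x : M, tangent x) : Prop :=
  forall f, smooth f -> forall x,
    tder (Z x) f =
      tder (X x) (fun y => tder (Y y) f) - tder (Y x) (fun y => tder (X y) f).

End Manifold.

(** * Vector bundles *)

Record trivialization (R : realType) (n : nat) (M : manifold R n)
    (E : M -> vectType R) := Trivialization {
  tdom : set M;
  trk : nat;
  tmap : forall x, 'Hom(E x, 'rV[R]_trk);
  tinv : forall x, 'Hom('rV[R]_trk, E x);
  tdom_open : open tdom;
  tmapK : forall x, tdom x -> cancel (tmap x) (tinv x);
  tinvK : forall x, tdom x -> cancel (tinv x) (tmap x) }.

(* The last axiom is the smoothness of the transition cocycle; the rank is only
   locally constant when M is not connected. *)
Record vbundle (R : realType) (n : nat) (M : manifold R n) := VBundle {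
  fiber :> M -> vectType R;
  trivs : set (trivialization fiber);
  trivs_cover : forall x, exists2 t, trivs t & tdom t x;
  trivs_compatible : forall t t', trivs t -> trivs t' ->
    forall (i : 'I_(trk t)) (j : 'I_(trk t')),
      smooth_on (tdom t `&` tdom t')
        (fun x => tmap t' x (tinv t x (delta_mx 0 i)) 0 j) }.

Section Bundle.
Context {R : realType} {n : nat} {M : manifold R n}.
Variable E : vbundle M.

Definition sect := forall x : M, E x.
Definition form1 := forall x : M, E x -> R.
Definition form2 := forall x : M, E x -> E x -> R.
Definition form3 := forall x : M, E x -> E x -> E x -> R.

Definition addS (u v : sect) : sect := fun x => u x + v x.
Definition oppS (u : sect) : sect := fun x => - u x.
Definition scaleS (f : M -> R) (u : sect) : sect := fun x => f x *: u x.
Definition addF (w w' : form1) : form1 := fun x a => w x a + w' x a.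
Definition scaleF (f : M -> R) (w : form1) : form1 := fun x a => f x * w x a.

Definition tframe (t : trivialization E) (i : 'I_(trk t)) : sect :=
  fun x => tinv t x (delta_mx 0 i).

(* X(E) *)
Definition smooth_sect : set sect :=
  [set u | forall t, trivs t -> forall i : 'I_(trk t),
     smooth_on (tdom t) (fun x => tmap t x (u x) 0 i)].

(* Omega^1(E) *)
Definition smooth_form1 : set form1 :=
  [set w | (forall x, scalar (w x)) /\
     (forall t, trivs t -> forall i : 'I_(trk t),
        smooth_on (tdom t) (fun x => w x (tframe i x)))].

(* sections of the second tensor power of the dual of E *)
Definition smooth_form2 : set form2 :=
  [set g | (forall x a, scalar (g x a) /\ scalar (fun b => g x b a)) /\
     (forall t, trivs t -> forall i j : 'I_(trk t),
        smooth_on (tdom t) (fun x => g x (tframe i x) (tframe j x)))].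

(* sections of the third tensor power of the dual of E *)
Definition smooth_form3 : set form3 :=
  [set C | (forall x a b, [/\ scalar (C x a b), scalar (fun c => C x a c b)
                            & scalar (fun c => C x c a b)]) /\
     (forall t, trivs t -> forall i j k : 'I_(trk t),
        smooth_on (tdom t)
          (fun x => C x (tframe i x) (tframe j x) (tframe k x)))].

Definition R_bilinear (B : sect -> sect -> sect) : Prop :=
  forall (a : R) u v w, smooth_sect u -> smooth_sect v -> smooth_sect w ->
    B (addS (scaleS (fun=> a) u) v) w =
      addS (scaleS (fun=> a) (B u w)) (B v w) /\
    B w (addS (scaleS (fun=> a) u) v) =
      addS (scaleS (fun=> a) (B w u)) (B w v).

Definition Cinf_linear (P : sect -> sect) : Prop :=
  forall f u v, smooth f -> smooth_sect u -> smooth_sect v ->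
    P (addS (scaleS f u) v) = addS (scaleS f (P u)) (P v).

Definition Cinf_bilinear (B : sect -> sect -> sect) : Prop :=
  forall w, smooth_sect w -> Cinf_linear (B w) /\ Cinf_linear (B^~ w).

Definition Cinf_multilinear (L : form1 -> sect -> sect -> sect) : Prop :=
  (forall w, smooth_form1 w -> Cinf_bilinear (L w)) /\
  (forall f w w' u v, smooth f -> smooth_form1 w -> smooth_form1 w' ->
     smooth_sect u -> smooth_sect v ->
     L (addF (scaleF f w) w') u v = addS (scaleS f (L w u v)) (L w' u v)).

Definition preserves_smooth2 (B : sect -> sect -> sect) : Prop :=
  forall u v, smooth_sect u -> smooth_sect v -> smooth_sect (B u v).

Definition E_metric (g : form2) : Prop :=
  [/\ smooth_form2 g,
      forall x a b, g x a b = g x b a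
    & forall x a, (forall b, g x a b = 0) -> a = 0].

Definition totally_symmetric (C : form3) : Prop :=
  forall x a b c, C x a b c = C x b a c /\ C x a b c = C x a c b.

(* A local frame (X_a) on U with dual coframe (e^a). The X_a and e^a are
   restrictions to U of global sections, so that C^oo(M)-multilinear operators
   apply to them; every local frame is of this form near each of its points. *)
Definition local_frame (U : set M) (r : nat) (X : 'I_r -> sect)
    (e : 'I_r -> form1) : Prop :=
  [/\ open U, forall a, smooth_sect (X a), forall a, smooth_form1 (e a),
      forall x, U x -> basis_of fullv [tuple X a x | a < r]
    & forall x, U x -> forall a b, e a x (X b x) = (a == b)%:R].

End Bundle.

Arguments addS {R n M E}.
Arguments oppS {R n M E}.
Arguments scaleS {R n M E}.
Arguments addF {R n M E}.
Arguments scaleF {R n M E}.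
Arguments E_metric {R n M E}.
Arguments totally_symmetric {R n M E}.
Arguments R_bilinear {R n M E}.
Arguments Cinf_linear {R n M E}.
Arguments Cinf_bilinear {R n M E}.
Arguments Cinf_multilinear {R n M E}.
Arguments preserves_smooth2 {R n M E}.
Arguments local_frame {R n M E} U {r} X e.

(** * Anchored bundles, connections, brackets *)

Section Anchored.
Context {R : realType} {n : nat} {M : manifold R n} {E : vbundle M}.

Implicit Types (rho : forall x : M, 'Hom(E x, tangent x)).
Implicit Types (nabla br : sect E -> sect E -> sect E).
Implicit Types (L : form1 E -> sect E -> sect E -> sect E).
Implicit Types (P : sect E -> sect E) (g : form2 E) (f : M -> R).
Implicit Types (u v w : sect E).

(* Smoothness of rho: its components in local trivializations of E and in
   charts of M are smooth; v(c^i) is the i-th component of v in the chart c. *)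
Definition anchor rho : Prop :=
  forall t c, trivs t -> atlas c -> forall (j : 'I_(trk t)) (i : 'I_n),
    smooth_on (tdom t `&` cdom c)
      (fun x => tder (rho x (tframe j x)) (fun y => c y 0 i)).

Definition regular rho : Prop :=
  forall x : M, \forall y \near x,
    \dim (limg (rho y)) = \dim (limg (rho x)).

(* rho(u)(f) *)
Definition rho_der rho u f : M -> R := fun x => tder (rho x (u x)) f.

Definition Dform rho f : form1 E := fun x a => tder (rho x a) f.

Definition connection rho nabla : Prop :=
  [/\ preserves_smooth2 nabla, R_bilinear nabla
    & forall f u v, smooth f -> smooth_sect u -> smooth_sect v ->
        nabla u (scaleS f v) =
          addS (scaleS (rho_der rho u f) v) (scaleS f (nabla u v)) /\
        nabla (scaleS f u) v = scaleS f (nabla u v)].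

Definition non_metricity rho nabla g u v w : M -> R := fun x =>
  rho_der rho u (fun y => g y (v y) (w y)) x
  - g x (nabla u v x) (w x) - g x (v x) (nabla u w x).

Definition almost_Leibniz rho br L : Prop :=
  [/\ anchor rho,
      preserves_smooth2 br /\ R_bilinear br,
      (forall om : form1 E, smooth_form1 om -> preserves_smooth2 (L om)) /\
        Cinf_multilinear L
    & forall f u v, smooth f -> smooth_sect u -> smooth_sect v ->
        br u (scaleS f v) =
          addS (scaleS (rho_der rho u f) v) (scaleS f (br u v)) /\
        br (scaleS f u) v =
          addS (addS (oppS (scaleS (rho_der rho v f) u)) (scaleS f (br u v)))
               (L (Dform rho f) u v)].

Definition pre_Leibniz rho br L : Prop :=
  almost_Leibniz rho br L /\
  forall u v, smooth_sect u -> smooth_sect v ->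
    is_lie_bracket (fun x => rho x (u x)) (fun x => rho x (v x))
                   (fun x => rho x (br u v x)).

(* L^ := P L *)
Definition projL P L : form1 E -> sect E -> sect E -> sect E :=
  fun om u v => P (L om u v).

Definition locality_projector rho L P : Prop :=
  [/\ forall u, smooth_sect u -> smooth_sect (P u),
      Cinf_linear P,
      forall (om : form1 E) u v,
        smooth_form1 om -> smooth_sect u -> smooth_sect v ->
        forall x, rho x (projL P L om u v x) = 0
    & forall u, smooth_sect u -> (forall x, rho x (u x) = 0) -> P u = u].

(* s is the section given, over every local frame, by L(e^a, nabla_{X_a} u, v) *)
Definition is_frame_trace L nabla u v (s : sect E) : Prop :=
  smooth_sect s /\
  forall (U : set M) (r : nat) (X : 'I_r -> sect E) (e : 'I_r -> form1 E),
    local_frame U X e -> forall x, U x ->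
      s x = \sum_(a < r) L (e a) (nabla (X a) u) v x.

(* L(e^a, nabla_{X_a} u, v), as a definite description *)
Definition frame_trace L nabla u v : sect E :=
  xget (fun x => 0) [set s | is_frame_trace L nabla u v s].

Definition admissible br L nabla : Prop :=
  forall u v, smooth_sect u -> smooth_sect v ->
    addS (br u v) (br v u) =
      addS (frame_trace L nabla u v) (frame_trace L nabla v u).

(* [u, v]_E^nabla; taking [projL P L] for L gives the projected bracket *)
Definition modified_bracket br L nabla u v : sect E :=
  addS (br u v) (oppS (frame_trace L nabla u v)).

(* T(nabla); taking [projL P L] for L gives the projected torsion *)
Definition torsion br L nabla u v : sect E :=
  addS (addS (nabla u v) (oppS (nabla v u)))
       (oppS (modified_bracket br L nabla u v)).

Definition projected_torsion_free br L P nabla : Prop :=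
  forall u v, smooth_sect u -> smooth_sect v ->
    torsion br (projL P L) nabla u v = fun x => 0.

Definition curvature br L P nabla u v w : sect E :=
  addS (addS (nabla u (nabla v w)) (oppS (nabla v (nabla u w))))
       (oppS (nabla (modified_bracket br (projL P L) nabla u v) w)).

Definition flat br L P nabla : Prop :=
  forall u v w, smooth_sect u -> smooth_sect v -> smooth_sect w ->
    curvature br L P nabla u v w = fun x => 0.

Definition hessian rho nabla f u v : M -> R := fun x =>
  rho_der rho u (rho_der rho v f) x - Dform rho f (nabla u v x).

(* The potential f need only be smooth on the neighbourhood U. *)
Definition locally_hessian rho nabla g : Prop :=
  forall p : M, exists (U : set M) (f : M -> R),
    [/\ open U, U p, smooth_on U f
      & forall u v, smooth_sect u -> smooth_sect v -> forall x, U x ->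
          g x (u x) (v x) = hessian rho nabla f u v x].

Definition hessian_structure rho br L P g nabla : Prop :=
  [/\ connection rho nabla, flat br L P nabla,
      projected_torsion_free br L P nabla,
      E_metric g & locally_hessian rho nabla g].

(* C is a map on sections; it has to be induced by a totally symmetric section
   of the third tensor power of the dual of E. *)
Definition statistical_structure g (C : sect E -> sect E -> sect E -> M -> R)
    (B : sect E -> sect E -> sect E) : Prop :=
  [/\ E_metric g,
      exists t : form3 E,
        [/\ smooth_form3 t, totally_symmetric t
          & forall u v w, smooth_sect u -> smooth_sect v -> smooth_sect w ->
              C u v w = fun x => t x (u x) (v x) (w x)],
      preserves_smooth2 B, Cinf_bilinear B
    & forall u v, smooth_sect u -> smooth_sect v -> B u v = oppS (B v u)].

End Anchored.

(* Main.v *)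
(* Near a point g = H(nabla)(f), where f may be cut off to a global
   smooth function. In Q(u,v,w) - Q(v,u,w) the third-order terms add up to
   [rho u, rho v](rho(w) f), and the remaining ones to the action on rho(w) f of
   nabla_u v - nabla_v u and to nabla_u nabla_v w - nabla_v nabla_u w -
   nabla_(nabla_u v - nabla_v u) w acting on f. Projected torsion-freeness gives
   nabla_u v - nabla_v u = [u,v]^, whose anchor is [rho u, rho v] because rho kills
   the image of P L, and flatness kills the rest; so Q is totally symmetric. It is
   C^oo-trilinear, hence pointwise, by the Leibniz rule.
   For the torsion, L(e^a, nabla_(X_a)(f u), v) = L(Df, u, v) + f L(e^a, nabla_(X_a) u, v)
   compensates the defect of the bracket in its first argument, and admissibility
   is antisymmetry.
   That C^oo-linear maps act pointwise, and that the frame contraction is well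
   defined, rests on smooth bump functions, built from exp(-1/t). *)
Require Import Defs.
From HB Require Import structures.
From mathcomp Require Import all_boot all_order all_algebra.
From mathcomp Require Import all_classical all_reals all_analysis.
From mathcomp Require Import ring lra.
Set Implicit Arguments.
Unset Strict Implicit.
Unset Printing Implicit Defensive.
Import Order.TTheory GRing.Theory Num.Theory.
Import numFieldNormedType.Exports.
Local Open Scope classical_set_scope.
Local Open Scope ring_scope.

(** * Germs of smooth functions *)

(** Write [g] as [(g - f) + f]: the difference vanishes near [x], hence is differentiable there with
    differential 0. *)
Lemma near_eq_differentiable (R : numFieldType) (V W : normedModType R)
    (f g : V -> W) (x : V) :
  (\near x, f x = g x) -> differentiable f x -> differentiable g x.
Proof.
move=> fg df; have fgx := nbhs_singleton fg.
suff dgf : differentiable (fun z => g z - f z) x.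
  rewrite (_ : g = (fun z => g z - f z) + f); first exact: differentiableD.
  by apply/funext => z /=; rewrite -[RHS]/(g z - f z + f z) subrK.
have e0 : (fun z => g z - f z) \o shift x
    = cst ((fun z => g z - f z) x) + (0 : V -> W) +o_ 0 id.
  apply/eqaddoP => _/posnumP[e]; near=> h => /=.
  rewrite -[X in `|X|]/(g (h + x) - f (h + x) - (g x - f x + 0)).
  have <- : f (h + x) = g (h + x).
    near: h; move: fg; rewrite (near_shift 0 x) /=.
    by apply: filterS => h; rewrite /= subr0.
  by rewrite fgx !subrr !addr0 subr0 normr0 mulr_ge0.
pose L0 : {linear V -> W} := \0.
apply/diff_locallyP.
have -> : ('d (fun z => g z - f z) x : V -> W) = L0.
  apply: diff_unique => //; exact: cst_continuous.
by split => //; exact: cst_continuous.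
Unshelve. all: by end_near. Qed.

(** * The flat function exp(-1/t) and its derivatives *)

Section FlatFunction.
Context {R : realType}.

(** The factor t^(-k) makes the linear span of the family closed under differentiation; k = 0 is the
    usual smooth function that is flat at 0. *)
Definition flatexp (k : nat) (t : R) : R :=
  if 0 < t then t^-1 ^+ k * expR (- t^-1) else 0.

Lemma flatexp_le0 k t : t <= 0 -> flatexp k t = 0.
Proof. by rewrite /flatexp leNgt; case: ifP. Qed.

Lemma flatexp_gt0 k t : 0 < t -> 0 < flatexp k t.
Proof.
by move=> t0; rewrite /flatexp t0 mulr_gt0 ?expR_gt0 ?exprn_gt0 ?invr_gt0.
Qed.

Lemma flatexp_ge0 k t : 0 <= flatexp k t.
Proof. by case: (leP t 0) => [/flatexp_le0->|/(flatexp_gt0 k)/ltW]. Qed.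

(** For t > 0 and x = 1/t this is the series bound x^(k+2)/(k+2)! <= exp x. A quadratic bound still
    leaves a factor t after division by t, so the difference quotient at 0 tends to 0. *)
Lemma flatexp_le_sqr k t : flatexp k t <= (k.+2)`!%:R * t ^+ 2.
Proof.
rewrite /flatexp; case: ltP => [t0|_]; last by rewrite mulr_ge0 ?sqr_ge0.
set x := t^-1; have x0 : 0 < x by rewrite invr_gt0.
have -> : t = x^-1 by rewrite invrK.
move: x x0 => {t t0} x x0.
have f0 : 0 < (k.+2)`!%:R :> R by rewrite ltr0n fact_gt0.
have := expR_ge1Dxn k.+1 (ltW x0).
rewrite expRN exprVn => h.
rewrite ler_pdivrMr ?expR_gt0// mulrAC ler_pdivlMr ?exprn_gt0// -exprD addn2.
have {h} : x ^+ k.+2 / (k.+2)`!%:R <= expR x by apply: le_trans h; rewrite lerDr.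
by rewrite ler_pdivrMr// [leRHS]mulrC.
Qed.

Lemma is_derive_flatexp k (t : R) :
  is_derive t 1 (flatexp k) (flatexp k.+2 t - k%:R * flatexp k.+1 t).
Proof.
case: (ltgtP t 0) => [t0|t0|->].
- rewrite !flatexp_le0 ?ltW// mulr0 subr0.
  apply: (@near_eq_is_derive _ _ _ (cst 0)).
  by near do rewrite flatexp_le0// ltW//; exact: lt_nbhsl.
- have tn0 : t != 0 by rewrite gt_eqF.
  have dV : is_derive t 1 (fun t : R => t^-1) (- t ^- 2).
    apply: DeriveDef.
      exact: (@derivableV _ _ id t 1 tn0 (@derivable_id _ _ _ _)).
    have -> := @deriveV _ _ id t 1 tn0 (@derivable_id _ _ _ _).
    by rewrite derive_id -[LHS]/(- t ^- 2 * 1) mulr1.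
  have dE : is_derive t 1 (fun t : R => expR (- t^-1)) (expR (- t^-1) * t ^- 2).
    have h1 : is_derive t 1 (fun t : R => - t^-1) (t ^- 2).
      by rewrite -[t ^- 2]opprK; exact: is_deriveN.
    have := @is_derive1_comp _ expR (fun t : R => - t^-1) t _ _ _ h1.
    by apply; exact: is_derive_expR.
  have dX := @is_deriveX _ _ (fun t : R => t^-1) k t 1 _ dV.
  rewrite exprfctE in dX.
  suff H : is_derive t 1 (fun t => t^-1 ^+ k * expR (- t^-1))
             (flatexp k.+2 t - k%:R * flatexp k.+1 t).
    apply: near_eq_is_derive H.
    by near=> z; rewrite /flatexp ifT//; near: z; exact: lt_nbhsr.
  have H := @is_deriveM _ _ (fun t : R => t^-1 ^+ k) _ _ _ _ _ dX dE.
  apply: (@is_derive_eq _ _ _ _ _ _ _ _ H).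
  rewrite /flatexp t0 -![_ *: _]/(_ * _) /=.
  (* The power rule lowers the exponent by one, so [k = 0] is treated apart. *)
  case: k {dX H} => [|k] /=.
    by rewrite -!exprVn; ring.
  rewrite -!exprVn !exprS -mulr_natr; ring.
- rewrite !flatexp_le0// mulr0 subr0.
  suff h : (fun h : R => h^-1 *: (flatexp k (h *: 1 + 0) - flatexp k 0)) @ 0^' --> 0.
    by apply: DeriveDef; [apply/cvg_ex; exists 0|exact: cvg_lim h].
  rewrite flatexp_le0//.
  (* At 0 the quotient is squeezed between -C|h| and C|h|, with the constant of [flatexp_le_sqr]. *)
  set C := (k.+2)`!%:R : R.
  have N : (fun h : R => C * `|h|) @ 0^' --> (0 : R).
    rewrite -[X in _ --> X](mulr0 C); apply: cvgMr; apply: cvg_within_filter.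
    by have := @norm_continuous _ R (0 : R); rewrite /continuous_at normr0.
  apply: (@squeeze_cvgr _ _ _ _ (fun h : R => - (C * `|h|)) (fun h : R => C * `|h|)).
  - near=> h; have hn0 : h != 0 by near: h; exact: nbhs_dnbhs_neq.
    rewrite -ler_norml subr0 addr0 -![_ *: _]/(_ * _) mulr1 normrM normfV.
    rewrite ler_pdivrMl ?normr_gt0// (ger0_norm (flatexp_ge0 _ _)).
    apply: le_trans (flatexp_le_sqr _ _) _.
    by rewrite [leRHS]mulrCA -expr2 real_normK ?num_real.
  - by rewrite -[X in _ --> X]oppr0; exact: (cvgN N).
  - exact: N.
Unshelve. all: by end_near. Qed.

End FlatFunction.

(** * Germs of finite and infinite order on R^n, and their closure properties *)

Section SmoothGerms.
Context {R : realType} {n : nat}.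
Local Notation rV := 'rV[R]_n.
Implicit Types (f g h : rV -> R) (y : rV).

Definition part (i : 'I_n) (h : rV -> R) : rV -> R := 'D_(delta_mx 0 i) h.
Definition parts (s : seq 'I_n) (h : rV -> R) : rV -> R :=
  foldr (fun i k => 'D_(delta_mx 0 i) k) h s.

(** Truncating the order makes induction possible. The derivatives of order up to [k] must
    themselves be differentiable, so [k = 0] already means differentiable near [y]. *)
Definition germ_ck (k : nat) y h :=
  forall s, (size s <= k)%N -> \forall z \near y, differentiable (parts s h) z.

(* The neighbourhood may shrink with the order of the derivative; on an open set
   this still amounts to [smooth_in]. *)
Definition germ_smooth y h :=
  forall s, \forall z \near y, differentiable (parts s h) z.

Lemma germ_smoothP y h : germ_smooth y h <-> forall k, germ_ck k y h.
Proof. by split=> [H k s _|H s]; [exact: H|exact: (H (size s))]. Qed.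

Lemma parts_rcons s i h : parts (rcons s i) h = parts s (part i h).
Proof. by rewrite /parts foldr_rcons. Qed.

(** Peels off the innermost derivative, the last entry of [s]. Closure under sums, products and
    composition with [flatexp] is proved by induction on [k] through this equivalence. *)
Lemma germ_ckS k y h : germ_ck k.+1 y h <->
  (\forall z \near y, differentiable h z) /\ forall i, germ_ck k y (part i h).
Proof.
split=> [H|[H0 H] s].
  split=> [|i s ss]; first exact: (H [::]).
  by rewrite -parts_rcons; apply: H; rewrite size_rcons.
case/lastP: s => [|s i]; first by [].
by rewrite size_rcons ltnS parts_rcons; exact: H.
Qed.

(** A derivative at [z] only sees the functions near [z]; [near_join] supplies equality near every
    point close to [y]. *)
Lemma near_eq_part i f g y :
  (\near y, f y = g y) -> \near y, part i f y = part i g y.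
Proof. by move=> /near_join; apply: filterS => z; exact: near_eq_derive. Qed.

Lemma near_eq_parts s f g y :
  (\near y, f y = g y) -> \near y, parts s f y = parts s g y.
Proof. by elim: s => //= i s IH fg; apply: near_eq_part; exact: IH. Qed.

Lemma near_eq_germ_ck k y f g :
  (\near y, f y = g y) -> germ_ck k y f -> germ_ck k y g.
Proof.
move=> fg fk s sk; have := near_join (near_eq_parts s fg).
by have := fk s sk; apply: filterS2 => z dz fgz; exact: near_eq_differentiable dz.
Qed.

Lemma near_eq_germ y f g :
  (\near y, f y = g y) -> germ_smooth y f -> germ_smooth y g.
Proof.
by move=> fg /germ_smoothP fs; apply/germ_smoothP => k; exact: near_eq_germ_ck fg _.
Qed.

Lemma germ_ck_le k l y h : (l <= k)%N -> germ_ck k y h -> germ_ck l y h.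
Proof. by move=> lk H s sl; apply: H; exact: leq_trans lk. Qed.

Lemma germ_ck_diff k y h : germ_ck k y h -> \forall z \near y, differentiable h z.
Proof. by move=> /(_ [::]); exact. Qed.

Lemma germ_ckD k y f g : germ_ck k y f -> germ_ck k y g -> germ_ck k y (f \+ g).
Proof.
elim: k f g => [|k IH] f g.
  move=> f0 g0 [|//] _; have := germ_ck_diff g0; have := germ_ck_diff f0.
  by apply: filterS2 => z fz gz; exact: differentiableD.
move=> /germ_ckS[f0 fS] /germ_ckS[g0 gS]; apply/germ_ckS; split=> [|i].
  by move: f0 g0; apply: filterS2 => z fz gz; exact: differentiableD.
apply: (@near_eq_germ_ck _ _ (part i f \+ part i g)); last by apply: IH.
move: f0 g0; apply: filterS2 => z fz gz /=.
by rewrite -deriveD//; exact: diff_derivable.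
Qed.

Lemma germ_ck_cst k y a : germ_ck k y (cst a).
Proof.
elim: k a => [|k IH] a; first by move=> [|//] _; near do exact: differentiable_cst.
apply/germ_ckS; split=> [|i]; first by near do exact: differentiable_cst.
by rewrite (_ : part i _ = cst 0)//; apply/funext => z; exact: derive_cst.
Unshelve. all: by end_near. Qed.

Lemma germ_ckM k y f g : germ_ck k y f -> germ_ck k y g -> germ_ck k y (f \* g).
Proof.
elim: k f g => [|k IH] f g.
  move=> f0 g0 [|//] _; have := germ_ck_diff g0; have := germ_ck_diff f0.
  by apply: filterS2 => z fz gz; exact: differentiableM.
move=> fk gk; have [f0 fS] := (germ_ckS _ _ _).1 fk.
have [g0 gS] := (germ_ckS _ _ _).1 gk.
apply/germ_ckS; split=> [|i].
  by move: f0 g0; apply: filterS2 => z fz gz; exact: differentiableM.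
(* The Leibniz rule; the undifferentiated factors have one order to spare, dropped by
   [germ_ck_le]. *)
apply: (@near_eq_germ_ck _ _ ((f \* part i g) \+ (g \* part i f))).
  move: f0 g0; apply: filterS2 => z fz gz /=.
  by rewrite /part deriveM//; exact: diff_derivable.
by apply: germ_ckD; apply: IH => //; exact: germ_ck_le (leqnSn k) _.
Qed.

Lemma germ_smooth_cst y a : germ_smooth y (cst a).
Proof. by apply/germ_smoothP => k; exact: germ_ck_cst. Qed.

Lemma germ_smoothD y f g :
  germ_smooth y f -> germ_smooth y g -> germ_smooth y (f \+ g).
Proof.
by move=> /germ_smoothP f0 /germ_smoothP g0; apply/germ_smoothP => k; exact: germ_ckD.
Qed.

Lemma germ_smoothM y f g :
  germ_smooth y f -> germ_smooth y g -> germ_smooth y (f \* g).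
Proof.
by move=> /germ_smoothP f0 /germ_smoothP g0; apply/germ_smoothP => k; exact: germ_ckM.
Qed.

Lemma germ_smooth_part i y f : germ_smooth y f -> germ_smooth y (part i f).
Proof. by move=> H s; rewrite -parts_rcons; exact: H. Qed.

Lemma germ_smooth_diff y h : germ_smooth y h -> \forall z \near y, differentiable h z.
Proof. by move=> /(_ [::]). Qed.

Lemma germ_smooth_coord y i : germ_smooth y (fun z : rV => z 0 i).
Proof.
apply/germ_smoothP; case=> [|k].
  by move=> [|//] _; near do exact: differentiable_coord.
apply/germ_ckS; split=> [|j]; first by near do exact: differentiable_coord.
rewrite (_ : part j _ = cst ((j == i)%:R)); first exact: germ_ck_cst.
apply/funext => z; rewrite /part deriveE; last exact: differentiable_coord.
(* The coordinate is bundled as a linear map, hence is its own differential. *)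
have @f : {linear rV -> R}.
  by exists (fun N : rV => N 0 i); do 2![eexists]; do ?[constructor];
     rewrite ?mxE// => ? *; rewrite ?mxE//; move=> ?; rewrite !mxE.
rewrite (_ : (fun z : rV => z 0 i) = f) // diff_lin; last exact: coord_continuous.
by rewrite /= mxE eqxx eq_sym.
Unshelve. all: by end_near. Qed.

(** The chain rule replaces the index [k] by [k.+1] and [k.+2], so the induction on the order is
    uniform in [k]. *)
Lemma germ_smooth_flatexp k y h :
  germ_smooth y h -> germ_smooth y (flatexp k \o h).
Proof.
move=> /germ_smoothP hs; apply/germ_smoothP => m.
have dfl j t : differentiable (@flatexp R j) t.
  by apply/derivable1_diffP; have [] := is_derive_flatexp j t.
elim: m k => [|m IH] k.
  move=> [|//] _; have := germ_ck_diff (hs 0%N).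
  by apply: filterS => z hz; exact: differentiable_comp.
have h0 := germ_ck_diff (hs 0%N).
apply/germ_ckS; split=> [|i].
  by move: h0; apply: filterS => z hz; exact: differentiable_comp.
apply: (@near_eq_germ_ck _ _
  (((flatexp k.+2 \o h) \+ (cst (- k%:R) \* (flatexp k.+1 \o h))) \* part i h)).
  move: h0; apply: filterS => z hz /=.
  rewrite /part [RHS]deriveE; last exact: differentiable_comp.
  rewrite diff_comp//= diff1E//= -deriveE// derive1E.
  have [_ ->] := is_derive_flatexp k (h z).
  by rewrite mulNr mulrC.
apply: germ_ckM; first apply: germ_ckD => //.
  by apply: germ_ckM => //; exact: germ_ck_cst.
by have /germ_ckS[] := hs m.+1.
Qed.

Lemma germ_smooth_sum (I : Type) (r : seq I) (f : I -> rV -> R) y :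
  (forall i, germ_smooth y (f i)) -> germ_smooth y (fun z => \sum_(i <- r) f i z).
Proof.
move=> H; elim: r => [|i r IH].
  by under eq_fun do rewrite big_nil; exact: germ_smooth_cst.
under eq_fun do rewrite big_cons.
exact: (germ_smoothD (H i) IH).
Qed.

End SmoothGerms.

(** * Smooth functions on a manifold *)

Section SmoothAt.
Context {R : realType} {n : nat} {M : manifold R n}.
Implicit Types (f g : M -> R) (x : M) (c : chart R n M).

Definition smooth_at x f := forall c, atlas c -> cdom c x ->
  germ_smooth (c x) (fun y => f (cinv c y)).

Lemma near_cinv c x (A : set M) : cdom c x -> nbhs x A ->
  \forall y \near c x, A (cinv c y).
Proof.
move=> cx Ax; have H : cinv c @ c x --> x.
  by rewrite -[X in _ --> X](cinvK cx); apply: cinv_cont; exact: imageP.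
exact: H.
Qed.

Lemma near_chart_img c x (U : set M) : open U -> U x -> cdom c x ->
  \forall y \near c x, (c @` (U `&` cdom c)) y.
Proof.
move=> oU Ux cx.
have hU := near_cinv cx (open_nbhs_nbhs (conj oU Ux)).
have : \forall y \near c x, (c @` cdom c) y.
  by apply: open_nbhs_nbhs; split; [exact: cimg_open|exact: imageP].
move: hU; apply: filterS2 => y /= hU [z cz zy]; exists z => //; split => //.
by move: hU; rewrite -zy cinvK.
Qed.

(** Reduces smoothness on an open set to germs, for which a different local expression may be used
    around each point. *)
Lemma smooth_onP (U : set M) f : open U ->
  smooth_on U f <-> forall x, U x -> smooth_at x f.
Proof.
move=> oU; split=> [H x Ux c ca cx s|H c ca s y [x [Ux cx] <-]].
  have := near_chart_img oU Ux cx; apply: filterS => y Vy.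
  exact: H.
exact: (nbhs_singleton (H x Ux c ca cx s)).
Qed.

Lemma smoothP f : smooth f <-> forall x, smooth_at x f.
Proof.
by split=> [/(smooth_onP _ openT) H x|H]; [exact: H|apply/(smooth_onP _ openT)].
Qed.

Lemma near_eq_smooth_at x f g :
  (\near x, f x = g x) -> smooth_at x f -> smooth_at x g.
Proof.
move=> fg fx c ca cx; apply: near_eq_germ (fx c ca cx).
exact: near_cinv cx fg.
Qed.

Lemma smooth_at_cst x (a : R) : smooth_at x (fun=> a).
Proof. by move=> c _ _; exact: germ_smooth_cst. Qed.

Lemma smooth_atD x f g :
  smooth_at x f -> smooth_at x g -> smooth_at x (fun z => f z + g z).
Proof. by move=> fx gx c ca cx; exact: germ_smoothD (fx _ ca cx) (gx _ ca cx). Qed.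

Lemma smooth_atM x f g :
  smooth_at x f -> smooth_at x g -> smooth_at x (fun z => f z * g z).
Proof. by move=> fx gx c ca cx; exact: germ_smoothM (fx _ ca cx) (gx _ ca cx). Qed.

Lemma smooth_atN x f : smooth_at x f -> smooth_at x (fun z => - f z).
Proof.
move=> fx; apply: near_eq_smooth_at (smooth_atM (@smooth_at_cst x (-1)) fx).
by apply: nearW => z; rewrite mulN1r.
Qed.

Lemma smooth_at_sum x (I : Type) (r : seq I) (F : I -> M -> R) :
  (forall i, smooth_at x (F i)) -> smooth_at x (fun z => \sum_(i <- r) F i z).
Proof. by move=> H c ca cx; apply: germ_smooth_sum => i; exact: H. Qed.

Lemma smooth_at_flatexp x k f : smooth_at x f -> smooth_at x (fun z => flatexp k (f z)).
Proof. by move=> fx c ca cx; exact: germ_smooth_flatexp (fx c ca cx). Qed.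

Lemma smooth_at_coord c x i : atlas c -> cdom c x ->
  smooth_at x (fun z => c z 0 i).
Proof.
move=> ca cx d da dx s.
have [_ H] := atlas_compatible da ca i.
have [H1 _] := atlas_compatible da ca i.
have := near_chart_img (@cdom_open _ _ _ c) cx dx.
rewrite setIC; apply: filterS => y; exact: H1.
Qed.

Lemma near_eq_tder x (v : tangent x) f g :
  (\near x, f x = g x) -> tder v f = tder v g.
Proof.
by move=> fg; rewrite /tder; apply: near_eq_derive; exact: near_cinv (chart_at_dom x) fg.
Qed.

Lemma smooth_at_diff x f c : atlas c -> cdom c x -> smooth_at x f ->
  \forall y \near c x, differentiable (fun y => f (cinv c y)) y.
Proof. by move=> ca cx fx; exact: germ_smooth_diff (fx c ca cx). Qed.

Lemma smooth_at_diff1 x f : smooth_at x f ->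
  differentiable (fun y => f (cinv (chart_at x) y)) (chart_at x x).
Proof.
move=> fx.
exact: (nbhs_singleton (smooth_at_diff (chart_at_atlas x) (chart_at_dom x) fx)).
Qed.

Lemma tderD x (v : tangent x) f g : smooth_at x f -> smooth_at x g ->
  tder v (fun z => f z + g z) = tder v f + tder v g.
Proof.
by move=> /smooth_at_diff1 fx /smooth_at_diff1 gx; apply: deriveD; exact: diff_derivable.
Qed.

Lemma tderM x (v : tangent x) f g : smooth_at x f -> smooth_at x g ->
  tder v (fun z => f z * g z) = f x * tder v g + g x * tder v f.
Proof.
move=> /smooth_at_diff1 fx /smooth_at_diff1 gx.
rewrite [LHS](@deriveM _ _ (fun y => f (cinv (chart_at x) y))
  (fun y => g (cinv (chart_at x) y))); [|exact: diff_derivable..].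
by rewrite (cinvK (chart_at_dom x)).
Qed.

Lemma tder_cst x (v : tangent x) (a : R) : tder v (fun=> a) = 0.
Proof. exact: derive_cst. Qed.

Lemma tderN x (v : tangent x) f : smooth_at x f ->
  tder v (fun z => - f z) = - tder v f.
Proof.
move=> fx; transitivity (tder v (fun z => -1 * f z)).
  by congr tder; apply/funext => z; rewrite mulN1r.
by rewrite tderM ?tder_cst ?mulr0 ?addr0 ?mulN1r//; exact: smooth_at_cst.
Qed.

Lemma tder_linear x f : smooth_at x f ->
  scalar (fun v : tangent x => tder v f).
Proof.
move=> /smooth_at_diff1 fx a v w.
by rewrite /tder !deriveE// linearP.
Qed.

(** Chain rule for the transition map from the preferred chart at [x] to [c]. As [chart_at x] need
    not vary continuously with [x], a fixed chart is used to follow how [tder] depends on the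
    point. *)
Lemma tder_chart x (v : tangent x) c f : atlas c -> cdom c x ->
  differentiable (fun y => f (cinv c y)) (c x) ->
  tder v f = \sum_(i < n) tder v (fun z => c z 0 i) *
                          part i (fun y => f (cinv c y)) (c x).
Proof.
move=> ca cx df.
pose F y := f (cinv c y); set e := chart_at x.
(* The transition map, written as a sum over coordinates so that its differentiability follows from
   that of each coordinate. *)
pose G (y : 'rV[R]_n) : 'rV[R]_n := \sum_(i < n) c (cinv e y) 0 i *: delta_mx 0 i.
have GE y : G y = c (cinv e y) by rewrite [RHS]row_sum_delta.
have dGi i : differentiable (fun y => c (cinv e y) 0 i) (e x).
  exact: smooth_at_diff1 (smooth_at_coord i ca cx).
have Ge : G (e x) = c x by rewrite GE /e (cinvK (chart_at_dom x)).
have dGi' i : differentiable (fun y : 'rV[R]_n =>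
    c (cinv e y) 0 i *: (delta_mx 0 i : 'rV[R]_n)) (e x).
  exact: differentiableZl.
have dG : differentiable G (e x).
  rewrite (_ : G = \sum_(i < n) (fun y : 'rV[R]_n =>
    c (cinv e y) 0 i *: (delta_mx 0 i : 'rV[R]_n))); first exact: differentiable_sum.
  by apply/funext => y; rewrite fct_sumE.
have dF : differentiable F (G (e x)) by rewrite Ge.
have -> : tder v f = 'D_v (F \o G) (e x).
  rewrite /tder; apply: near_eq_derive.
  have := near_cinv (chart_at_dom x) (open_nbhs_nbhs (conj (@cdom_open _ _ _ c) cx)).
  by apply: filterS => y cy; rewrite /= /F GE cinvK.
rewrite deriveE; last exact: differentiable_comp.
rewrite diff_comp// /= -(deriveE v dG).
have -> : 'D_v G (e x) = \sum_(i < n) 'D_v (fun y => c (cinv e y) 0 i) (e x) *: delta_mx 0 i.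
  rewrite (_ : G = \sum_(i < n) (fun y : 'rV[R]_n =>
    c (cinv e y) 0 i *: (delta_mx 0 i : 'rV[R]_n))); last first.
    by apply/funext => y; rewrite fct_sumE.
  rewrite derive_sum; last by move=> i; exact: diff_derivable.
  apply: eq_bigr => i _; rewrite deriveE// diffZl//=.
  by rewrite -deriveE.
rewrite linear_sum; apply: eq_bigr => i _.
rewrite linearZ/= Ge /part (deriveE _ df) /tder.
by congr (_ * _); rewrite (deriveE v (dGi i)).
Qed.

End SmoothAt.

(** * Bump functions on a Hausdorff manifold *)

Section Bump.
Context {R : realType} {n : nat} {M : manifold R n}.
Hypothesis hausM : hausdorff_space M.

(* [flatexp] vanishes on the nonpositive reals, so composing it with itself gives
   a function equal to 1 for [t <= 0] and to 0 for [1 <= t]. *)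
Definition plateau (t : R) : R :=
  flatexp 0 (flatexp 0 1 - flatexp 0 t) / flatexp 0 (flatexp 0 1).

Lemma plateau_le0 t : t <= 0 -> plateau t = 1.
Proof.
move=> t0; rewrite /plateau (flatexp_le0 _ t0) subr0 divff//.
by rewrite gt_eqF// !flatexp_gt0.
Qed.

Lemma plateau_ge1 t : 1 <= t -> plateau t = 0.
Proof.
move=> t1; have t0 : 0 < t by apply: lt_le_trans t1.
rewrite /plateau flatexp_le0 ?mul0r// subr_le0 /flatexp t0 ltr01 !expr0 !mul1r.
by rewrite ler_expR lerN2 lef_pV2// posrE.
Qed.

(** The plateau of a rescaled squared distance in a chart, extended by 0. The last clause is the
    support condition in the form used to extend local objects: off [U] the function vanishes on a
    whole neighbourhood. *)
Lemma bump_exists (p : M) (U : set M) : open U -> U p ->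
  exists b : M -> R, [/\ smooth b, \forall x \near p, b x = 1
    & forall x, U x \/ \forall z \near x, b z = 0].
Proof.
move=> oU Up; set c := chart_at p.
have ca : atlas c by exact: chart_at_atlas.
have cp : cdom c p by exact: chart_at_dom.
set q := c p.
have [e /= e0 He] : exists2 e : R, 0 < e & ball q e `<=` c @` (U `&` cdom c).
  by have /nbhs_ballP[e e0 H] := near_chart_img oU Up cp; exists e.
(* The squared Euclidean distance is smooth, unlike the sup norm of [ball]. The choice 2r = (e/2)^2
   puts the set s <= 2r inside the ball of radius e. *)
pose s (y : 'rV[R]_n) : R := \sum_(i < n) (y 0 i - q 0 i) * (y 0 i - q 0 i).
pose r := (e / 2) ^+ 2 / 2.
have r0 : 0 < r by rewrite divr_gt0// exprn_gt0// divr_gt0.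
have s_ball y : s y <= r *+ 2 -> ball q e y.
  move=> sy; split => // i j; rewrite (ord1 i) {i} /ball /= distrC.
  apply: (@le_lt_trans _ _ (e / 2)); last by rewrite ltr_pdivrMr// ltr_pMr// ltr1n.
  rewrite -(ler_pXn2r (n := 2))// ?nnegrE//; last by rewrite divr_ge0 ?ltW.
  rewrite real_normK ?num_real//.
  have <- : r *+ 2 = (e / 2) ^+ 2 by rewrite /r -mulr_natr divfK.
  apply: le_trans sy; rewrite /s (bigD1 j)//= expr2 lerDl.
  by apply: sumr_ge0 => i _; rewrite -expr2 sqr_ge0.
pose K' := [set y | s y <= r *+ 2].
have s_smooth y : germ_smooth y s.
  apply: germ_smooth_sum => i.
  have h : germ_smooth y (fun y : 'rV[R]_n => y 0 i - q 0 i).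
    exact: germ_smoothD (germ_smooth_coord y i) (germ_smooth_cst y (- q 0 i)).
  exact: (germ_smoothM h h).
have s_cont : continuous s.
  move=> y; apply: differentiable_continuous.
  exact: (nbhs_singleton (germ_smooth_diff (s_smooth y))).
(* A closed subset of a compact cube. *)
have K'comp : compact K'.
  apply: (@subclosed_compact _ _
    [set v : 'rV[R]_n | forall i, `[q 0 i - e, q 0 i + e]%classic (v ord0 i)]).
  - rewrite (_ : K' = s @^-1` [set t | t <= r *+ 2])//.
    by apply: preimage_closed => //; exact: closed_le.
  - apply: (@rV_compact _ _ (fun i => `[q 0 i - e, q 0 i + e]%classic)) => i.
    exact: segment_compact.
  - move=> y /s_ball[_ /(_ 0)] H i /=; have := H i; rewrite /ball /= distrC.
    by rewrite in_itv/= -ler_distl => /ltW.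
have K'img : K' `<=` c @` (U `&` cdom c) by move=> y /s_ball; exact: He.
pose K := cinv c @` K'.
(* The Hausdorff property makes the compact set [K] closed in all of [M], so the extension by 0 is
   smooth also at boundary points of the chart domain. *)
have Kcl : closed K.
  apply: compact_closed => //; apply: continuous_compact => //.
  apply: continuous_in_subspaceT => y /set_mem /K'img[z [_ cz] <-].
  by apply: cinv_cont; exact: imageP.
have KU : K `<=` U `&` cdom c.
  by move=> _ [y /K'img[z [Uz cz] <-] <-]; rewrite cinvK.
(* Equal to 1 for s <= r and to 0 for s >= 2r. *)
pose h x := plateau (r^-1 * s (c x) - 1).
pose b x := if pselect (cdom c x) then h x else 0.
have bh x : cdom c x -> b x = h x by rewrite /b; case: pselect.
have b0 x : ~ K x -> \forall z \near x, b z = 0.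
  move=> Kx; have : \forall z \near x, (~` K) z.
    by apply: open_nbhs_nbhs; split => //; exact: closed_openC.
  apply: filterS => z Kz; rewrite /b; case: pselect => // cz.
  apply: plateau_ge1; rewrite lerBrDr -mulr2n mulrC ler_pdivlMr// mulr_natl leNgt.
  by apply/negP => sz; apply: Kz; exists (c z); [exact: ltW|rewrite cinvK].
have h_smooth x : cdom c x -> smooth_at x h.
  move=> cx.
  have hs : smooth_at x (fun x => s (c x)).
    apply: smooth_at_sum => i.
    have k : smooth_at x (fun x => c x 0 i - q 0 i).
      by apply: smooth_atD (smooth_at_cst _); exact: smooth_at_coord.
    exact: smooth_atM.
  apply: smooth_atM (smooth_at_cst _).
  apply: smooth_at_flatexp; apply: smooth_atD (smooth_at_cst _) _.
  apply: smooth_atN; apply: smooth_at_flatexp; apply: smooth_atD (smooth_at_cst _).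
  exact: smooth_atM (smooth_at_cst _) hs.
exists b; split.
- apply/smoothP => x; have [/KU[_ cx]|/b0 bx] := pselect (K x).
    apply: near_eq_smooth_at (h_smooth x cx).
    apply: filterS (open_nbhs_nbhs (conj (@cdom_open _ _ _ c) cx)) => z cz.
    by rewrite bh.
  apply: near_eq_smooth_at (@smooth_at_cst _ _ _ x 0).
  by apply: filterS bx => z ->.
- have sp : s (c p) = 0 by apply: big1 => i _; rewrite subrr mul0r.
  have : \forall z \near p, s (c z) < r.
    have hc : {for p, continuous (s \o c)}.
      by apply: continuous_comp; [exact: chart_cont|exact: s_cont].
    have := hc [set t | t < r]; apply; rewrite /= sp.
    exact: lt_nbhsl.
  have := open_nbhs_nbhs (conj (@cdom_open _ _ _ c) cp).
  apply: filterS2 => z cz sz; rewrite bh// /h plateau_le0//.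
  by rewrite subr_le0 mulrC ler_pdivrMr// mul1r ltW.
- by move=> x; have [/KU[Ux _]|/b0 bx] := pselect (K x); [left|right].
Qed.

End Bump.

(** * Smooth sections and local frames *)

Lemma scalar_sum (R : pzRingType) (V : lmodType R) (f : V -> R) (I : Type) (r : seq I)
    (a : I -> R) (v : I -> V) : scalar f ->
  f (\sum_(i <- r) a i *: v i) = \sum_(i <- r) a i * f (v i).
Proof.
move=> fl; have f0 : f 0 = 0.
  by have := fl (-1) 0 0; rewrite scaler0 addr0 mulN1r addNr.
elim: r => [|i r IH]; first by rewrite !big_nil.
by rewrite !big_cons fl IH.
Qed.

Section SmoothSections.
Context {R : realType} {n : nat} {M : manifold R n} {E : vbundle M}.
Implicit Types (u v : sect E) (w : form1 E) (x : M) (f : M -> R)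
  (t : trivialization E).

Definition smooth_sect_at x u := forall t, trivs t -> tdom t x ->
  forall i : 'I_(trk t), smooth_at x (fun z => tmap t z (u z) 0 i).

Definition smooth_form1_at x w := forall t, trivs t -> tdom t x ->
  forall i : 'I_(trk t), smooth_at x (fun z => w z (tframe i z)).

Lemma smooth_sectP u : smooth_sect u <-> forall x, smooth_sect_at x u.
Proof.
split=> [us x t tt tx i|us t tt i].
  by have /(smooth_onP _ (@tdom_open _ _ _ _ t)) := us t tt i; apply.
by apply/(smooth_onP _ (@tdom_open _ _ _ _ t)) => x tx; exact: us.
Qed.

Lemma smooth_form1P w : smooth_form1 w <->
  (forall x, scalar (w x)) /\ forall x, smooth_form1_at x w.
Proof.
split=> -[ws H]; split=> //.
  move=> x t tt tx i.
  by have /(smooth_onP _ (@tdom_open _ _ _ _ t)) := H t tt i; apply.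
by move=> t tt i; apply/(smooth_onP _ (@tdom_open _ _ _ _ t)) => x tx; exact: H.
Qed.

Lemma near_eq_smooth_sect x u v :
  (\near x, u x = v x) -> smooth_sect_at x u -> smooth_sect_at x v.
Proof.
move=> uv us t tt tx i; apply: near_eq_smooth_at (us t tt tx i).
by apply: filterS uv => z ->.
Qed.

Lemma near_eq_smooth_form1 x w w' :
  (\near x, w x = w' x) -> smooth_form1_at x w -> smooth_form1_at x w'.
Proof.
move=> uv us t tt tx i; apply: near_eq_smooth_at (us t tt tx i).
by apply: filterS uv => z ->.
Qed.

Lemma smooth_sect_at_lin x f u v : smooth_at x f ->
  smooth_sect_at x u -> smooth_sect_at x v -> smooth_sect_at x (addS (scaleS f u) v).
Proof.
move=> fx ux vx t tt tx i.
apply: near_eq_smooth_at (smooth_atD (smooth_atM fx (ux t tt tx i)) (vx t tt tx i)).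
by apply: nearW => z; rewrite /addS /scaleS linearP !mxE.
Qed.

Lemma smooth_sect0 : smooth_sect ((fun=> 0) : sect E).
Proof.
apply/smooth_sectP => x t tt tx i.
apply: near_eq_smooth_at (@smooth_at_cst _ _ _ x 0).
by apply: nearW => z; rewrite linear0 mxE.
Qed.

Lemma smooth_sect_lin f u v : smooth f ->
  smooth_sect u -> smooth_sect v -> smooth_sect (addS (scaleS f u) v).
Proof.
move=> /smoothP fs /smooth_sectP us /smooth_sectP vs; apply/smooth_sectP => x.
exact: smooth_sect_at_lin.
Qed.

Lemma scaleS1 u : scaleS (fun=> 1) u = u.
Proof. by apply: functional_extensionality_dep => x; rewrite /scaleS scale1r. Qed.

Lemma addS0 u : addS u (fun=> 0) = u.
Proof. by apply: functional_extensionality_dep => x; rewrite /addS addr0. Qed.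

Lemma oppS_scale u : oppS u = scaleS (fun=> -1) u.
Proof. by apply: functional_extensionality_dep => x; rewrite /scaleS scaleN1r. Qed.

Lemma smooth_cst (a : R) : smooth (fun _ : M => a).
Proof. by apply/smoothP => x; exact: smooth_at_cst. Qed.

Lemma smooth_addS u v : smooth_sect u -> smooth_sect v -> smooth_sect (addS u v).
Proof.
move=> us vs; rewrite -[u]scaleS1; apply: smooth_sect_lin => //; exact: smooth_cst.
Qed.

Lemma smooth_scaleS f u : smooth f -> smooth_sect u -> smooth_sect (scaleS f u).
Proof.
by move=> fs us; rewrite -[scaleS _ _]addS0; apply: smooth_sect_lin => //; exact: smooth_sect0.
Qed.

Lemma smooth_oppS u : smooth_sect u -> smooth_sect (oppS u).
Proof. by move=> us; rewrite oppS_scale; apply: smooth_scaleS => //; exact: smooth_cst. Qed.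

Lemma smooth_form1_lin f w w' : smooth f ->
  smooth_form1 w -> smooth_form1 w' -> smooth_form1 (addF (scaleF f w) w').
Proof.
move=> /smoothP fs /smooth_form1P[ws wx] /smooth_form1P[ws' wx'].
apply/smooth_form1P; split=> [x a u v|x t tt tx i].
  by rewrite /addF /scaleF ws ws'; ring.
exact: (smooth_atD (smooth_atM (fs x) (wx x t tt tx i)) (wx' x t tt tx i)).
Qed.

Lemma smooth_form10 : smooth_form1 ((fun _ _ => 0) : form1 E).
Proof.
apply/smooth_form1P; split=> [x a u v|x t tt tx i]; first by rewrite mulr0 addr0.
exact: smooth_at_cst.
Qed.

Definition coframe t (i : 'I_(trk t)) : form1 E := fun x a => tmap t x a 0 i.

Lemma tframe_expand t x (a : E x) : tdom t x ->
  a = \sum_(i < trk t) coframe i a *: tframe i x.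
Proof.
move=> tx; rewrite -{1}(tmapK tx a) [tmap t x a]row_sum_delta linear_sum.
by apply: eq_bigr => i _; rewrite linearZ.
Qed.

Lemma coframe_tframe t x (i j : 'I_(trk t)) : tdom t x ->
  coframe i (tframe j x) = (i == j)%:R.
Proof. by move=> tx; rewrite /coframe /tframe tinvK// mxE eqxx. Qed.

Lemma smooth_tframe t x (i : 'I_(trk t)) : trivs t -> tdom t x ->
  smooth_sect_at x (tframe i).
Proof.
move=> tt tx t' tt' tx' j; have H := trivs_compatible tt tt' i j.
have oI : open (tdom t `&` tdom t') by apply: openI; exact: tdom_open.
by have /(smooth_onP _ oI) := H; apply.
Qed.

Lemma smooth_coframe t x (i : 'I_(trk t)) : trivs t -> tdom t x ->
  smooth_form1_at x (coframe i).
Proof.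
move=> tt tx t' tt' tx' j; have H := trivs_compatible tt' tt j i.
have oI : open (tdom t' `&` tdom t) by apply: openI; exact: tdom_open.
by have /(smooth_onP _ oI) := H; apply.
Qed.

Lemma smooth_pairing w u : smooth_form1 w -> smooth_sect u ->
  smooth (fun x => w x (u x)).
Proof.
move=> /smooth_form1P[wl ws] /smooth_sectP us; apply/smoothP => x.
have [t tt tx] := trivs_cover E x.
apply: (@near_eq_smooth_at _ _ _ _
  (fun z => \sum_(i < trk t) coframe i (u z) * w z (tframe i z))).
  have := open_nbhs_nbhs (conj (@tdom_open _ _ _ _ t) tx).
  by apply: filterS => z tz; rewrite [in RHS](tframe_expand (u z) tz) (scalar_sum _ _ _ (wl z)).
apply: smooth_at_sum => i; apply: smooth_atM; [exact: us|exact: ws].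
Qed.

(** * Cutting off local objects to global ones *)

Section Extension.
Variables (b : M -> R) (U : set M).
Hypotheses (bs : smooth b) (bU : forall x, U x \/ \forall z \near x, b z = 0).

Lemma bump_smooth f : (forall x, U x -> smooth_at x f) -> smooth (fun x => b x * f x).
Proof.
move=> fU; have /smoothP bx := bs; apply/smoothP => x.
have [Ux|b0] := bU x; first exact: smooth_atM (bx x) (fU x Ux).
apply: near_eq_smooth_at (@smooth_at_cst _ _ _ x 0).
by apply: filterS b0 => z ->; rewrite mul0r.
Qed.

Lemma bump_smooth_sect u : (forall x, U x -> smooth_sect_at x u) ->
  smooth_sect (scaleS b u).
Proof.
move=> fU; have /smoothP bx := bs; apply/smooth_sectP => x.
have [Ux|b0] := bU x.
  rewrite -[scaleS b u]addS0; apply: smooth_sect_at_lin => //; first exact: fU.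
  by have /smooth_sectP := smooth_sect0; apply.
have /smooth_sectP/(_ x) := smooth_sect0; apply: near_eq_smooth_sect.
by apply: filterS b0 => z b0; rewrite /scaleS b0 scale0r.
Qed.

Lemma bump_smooth_form1 w : (forall x, scalar (w x)) ->
  (forall x, U x -> smooth_form1_at x w) -> smooth_form1 (scaleF b w).
Proof.
move=> wl fU; have /smoothP bx := bs; apply/smooth_form1P; split=> [x a u v|x].
  by rewrite /scaleF wl; ring.
have [Ux t tt tx i|b0] := bU x; first exact: smooth_atM (bx x) (fU x Ux t tt tx i).
have /smooth_form1P[_ /(_ x)] := smooth_form10; apply: near_eq_smooth_form1.
by apply: filterS b0 => z b0; apply/funext => a; rewrite /scaleF b0 mul0r.
Qed.

End Extension.

(** * Local frames made of global sections *)

Section LocalFrames.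
Hypothesis hausM : hausdorff_space M.

Lemma smooth_ext (U : set M) f x : open U -> U x ->
  (forall z, U z -> smooth_at z f) ->
  exists2 F, smooth F & \forall z \near x, F z = f z.
Proof.
move=> oU Ux fU; have [b [bs b1 bU]] := bump_exists hausM oU Ux.
exists (fun x => b x * f x); first exact: bump_smooth bs bU _ fU.
by apply: filterS b1 => z ->; rewrite mul1r.
Qed.

(** Multiply the frame of a trivialization by a bump function and restrict to the interior of the
    set where the bump is 1. The last clause lets coefficients in the trivialization be computed
    with the global sections [X]. *)
Lemma local_frame_exists t p : trivs t -> tdom t p ->
  exists (U : set M) (X : 'I_(trk t) -> sect E) (e : 'I_(trk t) -> form1 E),
    [/\ local_frame U X e, U p
      & forall x, U x -> tdom t x /\ forall i, X i x = tframe i x].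
Proof.
move=> tt tp; have [b [bs b1 bU]] := bump_exists hausM (@tdom_open _ _ _ _ t) tp.
pose U := tdom t `&` [set x | b x = 1]°.
pose X i := scaleS b (@tframe _ _ _ E t i).
pose e i := scaleF b (@coframe t i).
have UX x : U x -> tdom t x /\ forall i, X i x = tframe i x.
  by move=> [tx /nbhs_singleton /= bx]; split => // i; rewrite /X /scaleS bx scale1r.
have Ue x i : U x -> e i x = coframe i (x := x).
  by move=> [tx /nbhs_singleton /= bx]; apply/funext => a; rewrite /e /scaleF bx mul1r.
exists U, X, e; split; [|split; [exact: tp|exact: b1]|exact: UX].
split.
- by apply: openI; [exact: tdom_open|exact: open_interior].
- by move=> i; apply: bump_smooth_sect bs bU _ _ => x tx; exact: smooth_tframe.
- move=> i; apply: bump_smooth_form1 bs bU _ _ _.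
    by move=> x a v w; rewrite /coframe linearP !mxE.
  by move=> x tx; exact: smooth_coframe.
- move=> x Ux; have [tx Xx] := UX x Ux.
  have XE : [tuple X a x | a < trk t] = [tuple @tframe _ _ _ E t a x | a < trk t].
    by apply: eq_mktuple.
  rewrite XE basisEfree. apply/and3P; split; [|exact: subvf|].
    (* Independence: read off the [i]-th coordinate of a vanishing combination. *)
    apply/freeP => k k0 i.
    have : tmap t x (\sum_(i < trk t) k i *: tframe i x) 0 i = 0.
      rewrite -[RHS](_ : (tmap t x 0) 0 i = 0); last by rewrite linear0 mxE.
      congr (tmap t x _ 0 i); rewrite -[RHS]k0; apply: eq_bigr => j _.
      by rewrite (nth_map j) ?size_enum_ord// nth_ord_enum.
    rewrite -[LHS]/(coframe i _) scalar_sum; last first.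
      by move=> a v w; rewrite /coframe linearP !mxE.
    rewrite (bigD1 i)//= coframe_tframe// eqxx mulr1 big1 ?addr0// => j ji.
    by rewrite coframe_tframe// eq_sym (negbTE ji) mulr0.
  rewrite size_tuple.
  (* Dimension count: [tmap t x] is injective, with values in a space of dimension [trk t]. *)
  have : (\dim (tmap t x @: fullv) <= trk t)%N.
    by apply: leq_trans (dimvS (subvf _)) _; rewrite dimvf /dim /= mul1n.
  rewrite limg_dim_eq// capfv; apply/eqP; rewrite -subv0; apply/subvP => a.
  rewrite memv_ker memv0 => /eqP a0.
  by rewrite -(tmapK tx a) a0 linear0.
- move=> x Ux i j; have [tx ->] := UX x Ux.
  by rewrite Ue// coframe_tframe.
Qed.

Lemma frame_expand (U : set M) r (X : 'I_r -> sect E) (e : 'I_r -> form1 E) x (a : E x) :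
  local_frame U X e -> U x -> a = \sum_(i < r) e i x a *: X i x.
Proof.
move=> Xe Ux; have [oU Xs es /(_ x Ux) XB /(_ x Ux) eX] := Xe.
have ae : a \in <<[tuple X i x | i < r]>>%VS.
  by rewrite (span_basis XB) memvf.
have aE : a = \sum_(i < r) coord [tuple X i x | i < r] i a *: X i x.
  rewrite {1}(coord_span ae); apply: eq_bigr => i _.
  by rewrite (nth_map i) ?size_enum_ord// nth_ord_enum.
rewrite {1}aE; apply: eq_bigr => i _; congr (_ *: _).
have /smooth_form1P[eil _] := es i.
rewrite [in RHS]aE (scalar_sum _ _ _ (eil x)) (bigD1 i)//= eX eqxx mulr1 big1 ?addr0// => j ji.
by rewrite eX eq_sym (negbTE ji) mulr0.
Qed.

Lemma form1_frame_expand (U : set M) r (X : 'I_r -> sect E) (e : 'I_r -> form1 E)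
    (w : form1 E) x (a : E x) :
  local_frame U X e -> scalar (w x) -> U x ->
  w x a = \sum_(i < r) w x (X i x) * e i x a.
Proof.
move=> Xe wl Ux; rewrite {1}(frame_expand a Xe Ux) (scalar_sum _ _ _ wl).
by apply: eq_bigr => i _; rewrite mulrC.
Qed.

End LocalFrames.

End SmoothSections.

(** * Tensoriality *)

(** Linear forms separate points. This turns identities between vectors of a fibre into scalar ones,
    within reach of [ring] and [lra]. *)
Lemma vect_scalar_ext (K : fieldType) (V : vectType K) (a b : V) :
  (forall phi : V -> K, scalar phi -> phi a = phi b) -> a = b.
Proof.
move=> H; rewrite (coord_vbasis (memvf a)) (coord_vbasis (memvf b)).
apply: eq_bigr => i _; congr (_ *: _); apply: (H (coord (vbasis fullv) i)).
by move=> k u v; rewrite linearP.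
Qed.

Lemma scalar_formD (K : pzRingType) (V : lmodType K) (phi : V -> K) : scalar phi ->
  forall a b, phi (a + b) = phi a + phi b.
Proof. by move=> h a b; have := h 1 a b; rewrite scale1r mul1r. Qed.

Lemma scalar_form0 (K : pzRingType) (V : lmodType K) (phi : V -> K) : scalar phi -> phi 0 = 0.
Proof. by move=> h; have := h (-1) 0 0; rewrite scaler0 addr0 mulN1r addNr. Qed.

Lemma scalar_formZ (K : pzRingType) (V : lmodType K) (phi : V -> K) : scalar phi ->
  forall k a, phi (k *: a) = k * phi a.
Proof. by move=> h k a; have := h k a 0; rewrite addr0 scalar_form0// addr0. Qed.

Lemma scalar_formN (K : pzRingType) (V : lmodType K) (phi : V -> K) : scalar phi ->
  forall a, phi (- a) = - phi a.
Proof. by move=> h a; rewrite -scaleN1r scalar_formZ// mulN1r. Qed.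

Section Tensorial.
Context {R : realType} {n : nat} {M : manifold R n} {E : vbundle M}.
Hypothesis hausM : hausdorff_space M.
Implicit Types (u v : sect E) (w : form1 E) (x : M) (f : M -> R).

(** Linearity over smooth functions, read at the single point [x]. With values in a fixed module,
    one notion serves both operators on sections, evaluated in a fibre, and scalar-valued
    tensors. *)
Definition tensor_at (W : lmodType R) x (F : sect E -> W) :=
  forall f u v, smooth f -> smooth_sect u -> smooth_sect v ->
    F (addS (scaleS f u) v) = f x *: F u + F v.

Definition cotensor_at (W : lmodType R) x (F : form1 E -> W) :=
  forall f w w', smooth f -> smooth_form1 w -> smooth_form1 w' ->
    F (addF (scaleF f w) w') = f x *: F w + F w'.

Lemma tensor_at_sum (W : lmodType R) x (F : sect E -> W) r (f : 'I_r -> M -> R)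
    (X : 'I_r -> sect E) : tensor_at x F ->
  (forall i, smooth (f i)) -> (forall i, smooth_sect (X i)) ->
  smooth_sect (fun z => \sum_(i < r) f i z *: X i z) /\
  F (fun z => \sum_(i < r) f i z *: X i z) = \sum_(i < r) f i x *: F (X i).
Proof.
move=> FT fs Xs; elim: (index_enum _) => [|i s [IHs IHF]].
  have -> : (fun z => \sum_(i <- [::]) f i z *: X i z) = fun=> 0.
    by apply: functional_extensionality_dep => z; rewrite big_nil.
  split; first exact: smooth_sect0.
  (* The coefficient -1 on zero sections gives F 0 = - F 0 + F 0 = 0. *)
  have := FT (fun=> -1) (fun=> 0) (fun=> 0) (smooth_cst _) smooth_sect0 smooth_sect0.
  rewrite big_nil -oppS_scale addS0 scaleN1r addNr.
  by rewrite (_ : oppS _ = fun=> 0)//; apply: functional_extensionality_dep => z; exact: oppr0.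
have -> : (fun z => \sum_(i <- i :: s) f i z *: X i z)
    = addS (scaleS (f i) (X i)) (fun z => \sum_(i <- s) f i z *: X i z).
  by apply: functional_extensionality_dep => z; rewrite big_cons.
split; first exact: smooth_sect_lin.
by rewrite big_cons FT// IHF.
Qed.

Lemma cotensor_at_sum (W : lmodType R) x (F : form1 E -> W) r (f : 'I_r -> M -> R)
    (e : 'I_r -> form1 E) : cotensor_at x F ->
  (forall i, smooth (f i)) -> (forall i, smooth_form1 (e i)) ->
  smooth_form1 (fun z a => \sum_(i < r) f i z * e i z a) /\
  F (fun z a => \sum_(i < r) f i z * e i z a) = \sum_(i < r) f i x *: F (e i).
Proof.
move=> FT fs es; elim: (index_enum _) => [|i s [IHs IHF]].
  have -> : (fun z a => \sum_(i <- [::]) f i z * e i z a) = fun _ _ => 0.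
    by apply: functional_extensionality_dep => z; apply/funext => a; rewrite big_nil.
  split; first exact: smooth_form10.
  have := FT (fun=> -1) (fun _ _ => 0) (fun _ _ => 0) (smooth_cst _) smooth_form10 smooth_form10.
  rewrite big_nil scaleN1r addNr => <-; congr F.
  apply: functional_extensionality_dep => z; apply/funext => a.
  by rewrite /addF /scaleF mulr0 addr0.
have -> : (fun z a => \sum_(i <- i :: s) f i z * e i z a)
    = addF (scaleF (f i) (e i)) (fun z a => \sum_(i <- s) f i z * e i z a).
  by apply: functional_extensionality_dep => z; apply/funext => a; rewrite big_cons.
split; first exact: smooth_form1_lin.
by rewrite big_cons FT// IHF.
Qed.

Section Frame.
Variables (U : set M) (r : nat).

(** Localisation: after multiplication by a bump [b] with b(x) = 1, the frame expansion holds on all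
    of [M], as b u = sum of b e^i(u) X_i. Apply [F] to both sides; the coefficients come out
    evaluated at [x]. *)
Lemma tensor_at_frame (W : lmodType R) x (F : sect E -> W) (X : 'I_r -> sect E)
    (e : 'I_r -> form1 E) u :
  local_frame U X e -> U x -> tensor_at x F -> smooth_sect u ->
  F u = \sum_(i < r) e i x (u x) *: F (X i).
Proof.
move=> Xe Ux FT us; have [oU Xs es _ _] := Xe.
have [b [bs b1 bU]] := bump_exists hausM oU Ux.
have bx : b x = 1 by exact: (nbhs_singleton b1).
pose f i := fun z => b z * e i z (u z).
have fs i : smooth (f i).
  apply/smoothP => z; apply: smooth_atM; first by move: z; apply/smoothP.
  by move: z; apply/smoothP; exact: smooth_pairing.
have [_] := tensor_at_sum FT fs Xs.
have -> : (fun z => \sum_(i < r) f i z *: X i z) = addS (scaleS b u) (fun=> 0).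
  apply: functional_extensionality_dep => z; rewrite addS0 /scaleS.
  have [Uz|/nbhs_singleton bz] := bU z.
    rewrite [in RHS](frame_expand (u z) Xe Uz) scaler_sumr.
    by apply: eq_bigr => i _; rewrite scalerA.
  rewrite bz scale0r big1// => i _.
  by rewrite /f bz mul0r scale0r.
have F0 : F (fun=> 0) = 0.
  have [_] := @tensor_at_sum W x F 0 (fun _ _ => 0) (fun=> (fun=> 0)) FT
     (fun=> smooth_cst 0) (fun=> smooth_sect0).
  rewrite [RHS]big_ord0 => <-; congr F.
  by apply: functional_extensionality_dep => z; rewrite big_ord0.
rewrite FT//; last exact: smooth_sect0.
rewrite F0 addr0 bx scale1r => ->.
by apply: eq_bigr => i _; rewrite /f bx mul1r.
Qed.

(** The dual argument, from the global identity b w = sum of b w(X_i) e^i. *)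
Lemma cotensor_at_frame (W : lmodType R) x (F : form1 E -> W) (X : 'I_r -> sect E)
    (e : 'I_r -> form1 E) w :
  local_frame U X e -> U x -> cotensor_at x F -> smooth_form1 w ->
  F w = \sum_(i < r) w x (X i x) *: F (e i).
Proof.
move=> Xe Ux FT ws; have [oU Xs es _ _] := Xe.
have [b [bs b1 bU]] := bump_exists hausM oU Ux.
have bx : b x = 1 by exact: (nbhs_singleton b1).
pose f i := fun z => b z * w z (X i z).
have fs i : smooth (f i).
  apply/smoothP => z; apply: smooth_atM; first by move: z; apply/smoothP.
  by move: z; apply/smoothP; exact: smooth_pairing.
have [_] := cotensor_at_sum FT fs es.
have -> : (fun z a => \sum_(i < r) f i z * e i z a)
    = addF (scaleF b w) (fun _ _ => 0).
  apply: functional_extensionality_dep => z; apply/funext => a.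
  rewrite /addF /scaleF addr0.
  have [Uz|/nbhs_singleton bz] := bU z.
    have /smooth_form1P[wl _] := ws.
    rewrite [in RHS](form1_frame_expand _ Xe (wl z) Uz) mulr_sumr.
    by apply: eq_bigr => i _; rewrite mulrA.
  rewrite bz mul0r big1// => i _.
  by rewrite /f bz mul0r mul0r.
have F0 : F (fun _ _ => 0) = 0.
  have [_] := @cotensor_at_sum W x F 0 (fun _ _ => 0) (fun=> (fun _ _ => 0)) FT
     (fun=> smooth_cst 0) (fun=> smooth_form10).
  rewrite [RHS]big_ord0 => <-; congr F.
  by apply: functional_extensionality_dep => z; apply/funext => a; rewrite big_ord0.
rewrite FT//; last exact: smooth_form10.
rewrite F0 addr0 bx scale1r => ->.
by apply: eq_bigr => i _; rewrite /f bx mul1r.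
Qed.

End Frame.

Lemma tensor_at_ext (W : lmodType R) x (F : sect E -> W) u v :
  tensor_at x F -> smooth_sect u -> smooth_sect v -> u x = v x -> F u = F v.
Proof.
move=> FT us vs uv; have [t tt tx] := trivs_cover E x.
have [U [X [e [Xe Ux _]]]] := local_frame_exists hausM tt tx.
by rewrite !(tensor_at_frame Xe Ux FT)// uv.
Qed.

Lemma sect_ext x (a : E x) : exists2 u, smooth_sect u & u x = a.
Proof.
have [t tt tx] := trivs_cover E x.
have [U [X [e [Xe Ux _]]]] := local_frame_exists hausM tt tx.
have [_ Xs _ _ _] := Xe.
(* Evaluation at [x] is tensorial, so [tensor_at_sum] also yields the smoothness of the
   combination. *)
have FT : tensor_at x (fun u => u x) by [].
have [us ux] := tensor_at_sum FT (fun i => smooth_cst (e i x a)) Xs.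
exists (fun z => \sum_i e i x a *: X i z) => //.
by rewrite -(frame_expand a Xe Ux).
Qed.

End Tensorial.

(** * Smoothness of the anchor acting on functions *)

Section Anchor.
Context {R : realType} {n : nat} {M : manifold R n} {E : vbundle M}.
Variable rho : forall x : M, 'Hom(E x, tangent x).
Hypothesis rho_smooth : anchor rho.
Implicit Types (u v : sect E) (w : form1 E) (x : M) (f : M -> R).

Lemma Dform_linear f x : smooth f -> scalar (@Dform _ _ _ _ rho f x).
Proof.
move=> /smoothP fs k a b; rewrite /Dform linearP.
exact: (tder_linear (fs x)).
Qed.

(** In a fixed chart [c], Df(X_j) is the sum over i of rho(X_j)(c^i) times the i-th partial
    derivative of [f]. The first factors are smooth by [anchor], and the preferred charts disappear
    from the expression. *)
Lemma smooth_Dform f : smooth f -> smooth_form1 (Dform rho f).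
Proof.
move=> fs; apply/smooth_form1P; split=> [x|x t tt tx j]; first exact: Dform_linear.
move=> c ca cx; have /smoothP fx := fs.
have oI : open (tdom t `&` cdom c).
  by apply: openI; [exact: tdom_open|exact: cdom_open].
pose G i (z : M) := tder (rho z (tframe j z)) (fun y => c y 0 i).
apply: (@near_eq_germ _ _ _ (fun y => \sum_(i < n) G i (cinv c y) *
    part i (fun y => f (cinv c y)) y)).
  have := near_chart_img (@cdom_open _ _ _ c) cx cx.
  have := smooth_at_diff ca cx (fx x).
  apply: filterS2 => y dy [z [_ cz] zy].
  by rewrite /Dform (tder_chart _ ca (x := cinv c y)) -zy cinvK// zy.
apply: germ_smooth_sum => i; apply: germ_smoothM; last first.
  exact: germ_smooth_part (fx x c ca cx).
have /(smooth_onP _ oI) H := rho_smooth tt ca j i.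
exact: (H x (conj tx cx) c ca cx).
Qed.

Lemma smooth_rho_der u f : smooth_sect u -> smooth f -> smooth (rho_der rho u f).
Proof. by move=> us fs; exact: smooth_pairing (smooth_Dform fs) us. Qed.

End Anchor.

(** * Connections *)

Section Connections.
Context {R : realType} {n : nat} {M : manifold R n} {E : vbundle M}.
Hypothesis hausM : hausdorff_space M.
Variable rho : forall x : M, 'Hom(E x, tangent x).
Hypothesis rho_smooth : anchor rho.
Variable nabla : sect E -> sect E -> sect E.
Hypothesis nablaP : connection rho nabla.
Implicit Types (u v w : sect E) (om : form1 E) (x : M) (f : M -> R)
  (L : form1 E -> sect E -> sect E -> sect E).

Lemma R_bilinearD (B : sect E -> sect E -> sect E) u v w : R_bilinear B ->
  smooth_sect u -> smooth_sect v -> smooth_sect w ->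
  B (addS u v) w = addS (B u w) (B v w) /\ B w (addS u v) = addS (B w u) (B w v).
Proof. by move=> BR us vs ws; have := BR 1 _ _ _ us vs ws; rewrite !scaleS1. Qed.

Lemma nabla_smooth u v : smooth_sect u -> smooth_sect v -> smooth_sect (nabla u v).
Proof. by have [H _ _] := nablaP; exact: H. Qed.

Lemma nabla_linl f u v w : smooth f -> smooth_sect u -> smooth_sect v -> smooth_sect w ->
  nabla (addS (scaleS f u) v) w = addS (scaleS f (nabla u w)) (nabla v w).
Proof.
move=> fs us vs ws; have [_ H1 H2] := nablaP.
have [-> _] := R_bilinearD H1 (smooth_scaleS fs us) vs ws.
by have [_ ->] := H2 f u w fs us ws.
Qed.

Lemma nabla_linr f u v w : smooth f -> smooth_sect u -> smooth_sect v -> smooth_sect w ->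
  nabla w (addS (scaleS f u) v) =
    addS (addS (scaleS (rho_der rho w f) u) (scaleS f (nabla w u))) (nabla w v).
Proof.
move=> fs us vs ws; have [_ H1 H2] := nablaP.
have [_ ->] := R_bilinearD H1 (smooth_scaleS fs us) vs ws.
by have [-> _] := H2 f w u fs ws us.
Qed.

(** * The contraction of L with the connection over a local frame *)

Section FrameTrace.
Variable L : form1 E -> sect E -> sect E -> sect E.
Hypothesis L_smooth : forall om : form1 E, smooth_form1 om -> preserves_smooth2 (L om).
Hypothesis L_lin : Cinf_multilinear L.

Lemma multilinear1 u v x : smooth_sect u -> smooth_sect v ->
  cotensor_at x (fun om => L om u v x).
Proof.
move=> us vs f w w' fs ws ws'; have [_ H] := L_lin.
by rewrite H.
Qed.

Lemma multilinear2 om f u u' v : smooth_form1 om -> smooth f -> smooth_sect u ->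
  smooth_sect u' -> smooth_sect v ->
  L om (addS (scaleS f u) u') v = addS (scaleS f (L om u v)) (L om u' v).
Proof.
move=> oms fs us us' vs; have [H _] := L_lin.
by have [_ h] := H om oms v vs; exact: h.
Qed.

(** The sum of the e^a tensor X_a is frame independent. Expand each X'_a in the frame X, using
    linearity of nabla in its first slot, exchange the sums, and recognise the expansion of each e^b
    in the coframe e'. *)
Lemma trace_independent u v x (U U' : set M) r r' (X : 'I_r -> sect E) e
    (X' : 'I_r' -> sect E) e' :
  local_frame U X e -> local_frame U' X' e' -> U x -> U' x ->
  smooth_sect u -> smooth_sect v ->
  \sum_(a < r) L (e a) (nabla (X a) u) v x =
  \sum_(a < r') L (e' a) (nabla (X' a) u) v x.
Proof.
move=> Xe Xe' Ux Ux' us vs.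
have [_ Xs es _ _] := Xe; have [_ Xs' es' _ _] := Xe'.
have T1 om : smooth_form1 om -> tensor_at x (fun w => L om (nabla w u) v x).
  move=> oms f w w' fs ws ws'; rewrite nabla_linl// multilinear2//; exact: nabla_smooth.
under [RHS]eq_bigr => a _.
  rewrite (tensor_at_frame hausM Xe Ux (T1 _ (es' a)) (Xs' a)).
  over.
rewrite exchange_big; apply: eq_bigr => b _ /=.
rewrite (cotensor_at_frame hausM Xe' Ux'
  (@multilinear1 (nabla (X b) u) v x (nabla_smooth (Xs b) us) vs) (es b)).
by [].
Qed.

(** The description has a witness, so [xget] does not fall back to its default: frame independence
    lets a value be chosen fibre by fibre, and smoothness is checked near each point in one
    frame. *)
Lemma frame_traceP u v : smooth_sect u -> smooth_sect v ->
  is_frame_trace L nabla u v (frame_trace L nabla u v).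
Proof.
move=> us vs; apply: xgetPex.
have H x : exists s : E x, forall (U : set M) (r : nat) (X : 'I_r -> sect E)
    (e : 'I_r -> form1 E), local_frame U X e -> U x ->
    s = \sum_(a < r) L (e a) (nabla (X a) u) v x.
  have [t tt tx] := trivs_cover E x.
  have [U [X [e [Xe Ux _]]]] := local_frame_exists hausM tt tx.
  exists (\sum_(a < trk t) L (e a) (nabla (X a) u) v x) => U' r' X' e' Xe' Ux'.
  exact: (trace_independent Xe Xe').
exists (fun x => sval (cid (H x))); split; last first.
  by move=> U r X e Xe x Ux; case: (cid (H x)) => s /= /(_ _ _ _ _ Xe Ux).
apply/smooth_sectP => x.
have [t tt tx] := trivs_cover E x.
have [U [X [e [Xe Ux _]]]] := local_frame_exists hausM tt tx.
have [oU Xs es _ _] := Xe.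
have FT : tensor_at x (fun u : sect E => u x) by [].
have [ss _] := tensor_at_sum FT (fun=> smooth_cst 1)
  (fun a => L_smooth (es a) (nabla_smooth (Xs a) us) vs).
move/smooth_sectP/(_ x) : ss; apply: near_eq_smooth_sect.
apply: filterS (open_nbhs_nbhs (conj oU Ux)) => z Uz.
case: (cid (H z)) => s /= /(_ _ _ _ _ Xe Uz) ->.
by apply: eq_bigr => a _; rewrite scale1r.
Qed.

Lemma smooth_frame_trace u v : smooth_sect u -> smooth_sect v ->
  smooth_sect (frame_trace L nabla u v).
Proof. by move=> us vs; have [] := frame_traceP us vs. Qed.

Lemma frame_traceE (U : set M) r (X : 'I_r -> sect E) e u v x :
  local_frame U X e -> U x -> smooth_sect u -> smooth_sect v ->
  frame_trace L nabla u v x = \sum_(a < r) L (e a) (nabla (X a) u) v x.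
Proof. by move=> Xe Ux us vs; have [_ H] := frame_traceP us vs; exact: H Xe x Ux. Qed.

(** The derivative terms of nabla_(X_a)(f u) contribute the sum of rho(X_a)(f) L(e^a, u, v), which
    is L(Df, u, v) because Df is the sum of rho(X_a)(f) e^a. *)
Lemma frame_trace_linl f u u' v x : smooth f -> smooth_sect u -> smooth_sect u' ->
  smooth_sect v ->
  frame_trace L nabla (addS (scaleS f u) u') v x =
    L (Dform rho f) u v x + f x *: frame_trace L nabla u v x
    + frame_trace L nabla u' v x.
Proof.
move=> fs us us' vs; have [t tt tx] := trivs_cover E x.
have [U [X [e [Xe Ux _]]]] := local_frame_exists hausM tt tx.
have [oU Xs es _ _] := Xe.
rewrite !(frame_traceE Xe Ux)//; last exact: smooth_sect_lin.
rewrite (cotensor_at_frame hausM Xe Ux (multilinear1 x us vs) (smooth_Dform rho_smooth fs)).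
rewrite scaler_sumr -!big_split; apply: eq_bigr => a _ /=.
have ds := smooth_rho_der rho_smooth (Xs a) fs.
have nu := nabla_smooth (Xs a) us; have nu' := nabla_smooth (Xs a) us'.
(* Only re-brackets the sum, so that [multilinear2] applies twice. *)
rewrite nabla_linr// -[addS (addS _ _) _]addS0.
have -> : addS (addS (addS (scaleS (rho_der rho (X a) f) u) (scaleS f (nabla (X a) u)))
      (nabla (X a) u')) (fun=> 0)
    = addS (scaleS (rho_der rho (X a) f) u)
        (addS (scaleS f (nabla (X a) u)) (nabla (X a) u')).
  by apply: functional_extensionality_dep => z; rewrite /addS addr0 addrA.
rewrite multilinear2//; last exact: smooth_sect_lin.
by rewrite multilinear2// /addS /scaleS addrA.
Qed.

End FrameTrace.

Lemma rho_frame_trace L : (forall om u v, smooth_form1 om -> smooth_sect u ->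
    smooth_sect v -> forall x, rho x (L om u v x) = 0) ->
  forall u v, smooth_sect u -> smooth_sect v ->
  forall x, rho x (frame_trace L nabla u v x) = 0.
Proof.
move=> L0 u v us vs x; rewrite /frame_trace.
(* The default of the description is the zero section, which [rho] kills as well. *)
case: xgetP => [s -> [_ sE]|_]; last by rewrite linear0.
have [t tt tx] := trivs_cover E x.
have [U [X [e [Xe Ux _]]]] := local_frame_exists hausM tt tx.
have [oU Xs es _ _] := Xe.
rewrite (sE _ _ _ _ Xe x Ux) linear_sum big1// => a _.
by apply: L0 => //; exact: nabla_smooth.
Qed.

(** * The non-metricity as a tensor *)

Section NonMetricity.
Variable g : form2 E.
Arguments g : clear implicits.
Hypothesis gP : E_metric g.

Lemma metric_scalarl x a : scalar (fun b => g x b a).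
Proof. by have [[H _] _ _] := gP; have [] := H x a. Qed.

Lemma metric_scalarr x a : scalar (g x a).
Proof. by have [[H _] _ _] := gP; have [] := H x a. Qed.

Lemma metric_form1 u : smooth_sect u -> smooth_form1 (fun x a => g x (u x) a).
Proof.
move=> us; have [[gl gs] _ _] := gP; apply/smooth_form1P; split=> [x|x t tt tx j].
  exact: metric_scalarr.
apply: (@near_eq_smooth_at _ _ _ _
  (fun z => \sum_(i < trk t) coframe i (u z) * g z (tframe i z) (tframe j z))).
  have := open_nbhs_nbhs (conj (@tdom_open _ _ _ _ t) tx).
  apply: filterS => z tz; rewrite [in RHS](tframe_expand (u z) tz).
  by rewrite (scalar_sum _ _ _ (metric_scalarl _)).
apply: smooth_at_sum => i; apply: smooth_atM.
  by have /smooth_sectP := us; apply.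
by have /(smooth_onP _ (@tdom_open _ _ _ _ t)) := gs t tt i j; apply.
Qed.

Lemma smooth_metric u v : smooth_sect u -> smooth_sect v ->
  smooth (fun x => g x (u x) (v x)).
Proof. by move=> us vs; exact: smooth_pairing (metric_form1 us) vs. Qed.

Let Q := non_metricity rho nabla g.

Lemma smooth_non_metricity u v w : smooth_sect u -> smooth_sect v -> smooth_sect w ->
  smooth (Q u v w).
Proof.
move=> us vs ws; apply/smoothP => x.
have h1 := smooth_rho_der rho_smooth us (smooth_metric vs ws).
have h2 := smooth_metric (nabla_smooth us vs) ws.
have h3 := smooth_metric vs (nabla_smooth us ws).
move/smoothP/(_ x) : h1 => h1; move/smoothP/(_ x) : h2 => h2.
move/smoothP/(_ x) : h3 => h3.
exact: (smooth_atD (smooth_atD h1 (smooth_atN h2)) (smooth_atN h3)).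
Qed.

Lemma non_metricity_sym23 u v w : Q u v w = Q u w v.
Proof.
have [_ gs _] := gP; apply/funext => x; rewrite /Q /non_metricity.
have -> : (fun y => g y (v y) (w y)) = (fun y => g y (w y) (v y)).
  by apply/funext => y; exact: gs.
by rewrite addrAC; congr (_ - _ - _); exact: gs.
Qed.

Lemma non_metricity_tensor1 x v w : smooth_sect v -> smooth_sect w ->
  tensor_at x (fun u => Q u v w x : R^o).
Proof.
move=> vs ws f u u' fs us us'; rewrite /Q /non_metricity !nabla_linl//.
rewrite /rho_der /addS /scaleS.
rewrite -![tder _ _]/(Dform rho (fun y => g y (v y) (w y)) _).
rewrite (Dform_linear rho (x := x) (smooth_metric vs ws)).
rewrite metric_scalarl metric_scalarr -![_ *: _]/(_ * _); ring.
Qed.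

(** The term rho(u)(f) g(v, w) arises once from differentiating g(f v, w) and once, with the
    opposite sign, from nabla_u (f v). *)
Lemma non_metricity_tensor2 x u w : smooth_sect u -> smooth_sect w ->
  tensor_at x (fun v => Q u v w x : R^o).
Proof.
move=> us ws f v v' fs vs vs'; rewrite /Q /non_metricity !nabla_linr//.
have -> : (fun y => g y (addS (scaleS f v) v' y) (w y))
    = (fun y => f y * g y (v y) (w y) + g y (v' y) (w y)).
  by apply/funext => y; rewrite /addS /scaleS metric_scalarl.
have gvw := smooth_metric vs ws; have gvw' := smooth_metric vs' ws.
move/smoothP/(_ x) : (gvw) => gx; move/smoothP/(_ x) : (gvw') => gx'.
move/smoothP/(_ x) : (fs) => fx.
rewrite /rho_der tderD//; last exact: smooth_atM.
rewrite tderM// /addS /scaleS /rho_der.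
rewrite !(scalar_formD (metric_scalarl _)) !(scalar_formZ (metric_scalarl _)).
rewrite -![_ *: _]/(_ * _); ring.
Qed.

Lemma non_metricity_tensor3 x u v : smooth_sect u -> smooth_sect v ->
  tensor_at x (fun w => Q u v w x : R^o).
Proof.
move=> us vs f w w' fs ws ws'; rewrite !(non_metricity_sym23 u v).
exact: non_metricity_tensor2.
Qed.

(** The fibre form is evaluated on arbitrarily chosen global extensions of its arguments;
    tensoriality in each slot makes the choice immaterial. *)
Lemma non_metricity_form3 : exists t : form3 E, smooth_form3 t /\
  forall u v w, smooth_sect u -> smooth_sect v -> smooth_sect w ->
    Q u v w = fun x => t x (u x) (v x) (w x).
Proof.
pose ext x (a : E x) : sect E := sval (cid2 (sect_ext hausM a)).
have exts x (a : E x) : smooth_sect (ext x a) by rewrite /ext; case: cid2.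
have extE x (a : E x) : ext x a x = a by rewrite /ext; case: cid2.
pose t : form3 E := fun x a b c => Q (ext x a) (ext x b) (ext x c) x.
have tE u v w : smooth_sect u -> smooth_sect v -> smooth_sect w ->
    forall x, Q u v w x = t x (u x) (v x) (w x).
  move=> us vs ws x; rewrite /t.
  rewrite (tensor_at_ext hausM (non_metricity_tensor1 x vs ws) us (exts x (u x)))//.
  rewrite (tensor_at_ext hausM (non_metricity_tensor2 x (exts _ _) ws) vs (exts x (v x)))//.
  by rewrite (tensor_at_ext hausM
    (non_metricity_tensor3 x (exts _ _) (exts _ _)) ws (exts x (w x))).
(* A combination of vectors is extended by the constant-coefficient combination of the chosen
   sections, which carries linearity over to [t]. *)
have tlin x (a b : E x) k : smooth_sect (addS (scaleS (fun=> k) (ext x a)) (ext x b)).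
  by apply: smooth_sect_lin => //; exact: smooth_cst.
have linE x (a b : E x) k : addS (scaleS (fun=> k) (ext x a)) (ext x b) x = k *: a + b.
  by rewrite /addS /scaleS !extE.
exists t; split; last by move=> u v w us vs ws; apply/funext => x; exact: tE.
split=> [x a b|s ss i j k].
  split=> l c d.
  - rewrite -{1}(extE x a) -{1}(extE x b) -(linE x c d l) -tE//.
    by rewrite (non_metricity_tensor3 x (exts _ _) (exts _ _) (smooth_cst l)).
  - rewrite -{1}(extE x a) -{1}(extE x b) -(linE x c d l) -tE//.
    by rewrite (non_metricity_tensor2 x (exts _ _) (exts _ _) (smooth_cst l)).
  - rewrite -{1}(extE x a) -{1}(extE x b) -(linE x c d l) -tE//.
    by rewrite (non_metricity_tensor1 x (exts _ _) (exts _ _) (smooth_cst l)).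
(* Near [x] the trivialization frame agrees with global sections, on which [t] is computed by
   [Q]. *)
apply/(smooth_onP _ (@tdom_open _ _ _ _ s)) => x sx.
have [U [X [e [Xe Ux XU]]]] := local_frame_exists hausM ss sx.
have [oU Xs _ _ _] := Xe.
have /smoothP/(_ x) := smooth_non_metricity (Xs i) (Xs j) (Xs k).
apply: near_eq_smooth_at.
apply: filterS (open_nbhs_nbhs (conj oU Ux)) => z Uz.
by have [_ XE] := XU z Uz; rewrite tE// !XE.
Qed.

End NonMetricity.

End Connections.

(** * Hessian structures *)

Section Hessian.
Context {R : realType} {n : nat} {M : manifold R n} {E : vbundle M}.
Hypothesis hausM : hausdorff_space M.
Variable rho : forall x : M, 'Hom(E x, tangent x).
Variables (br : sect E -> sect E -> sect E) (L : form1 E -> sect E -> sect E -> sect E).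
Hypothesis preL : pre_Leibniz rho br L.
Variable nabla : sect E -> sect E -> sect E.
Hypothesis nablaP : connection rho nabla.
Implicit Types (u v w : sect E) (x : M) (f : M -> R).

Lemma nablaBl u v w : smooth_sect u -> smooth_sect v -> smooth_sect w ->
  nabla (addS u (oppS v)) w = addS (nabla u w) (oppS (nabla v w)).
Proof.
move=> us vs ws.
have -> : addS u (oppS v) = addS (scaleS (fun=> -1) v) u.
  apply: functional_extensionality_dep => x.
  by rewrite /addS /oppS /scaleS scaleN1r addrC.
rewrite (nabla_linl nablaP)//; last exact: smooth_cst.
apply: functional_extensionality_dep => x.
by rewrite /addS /oppS /scaleS scaleN1r addrC.
Qed.

Lemma rho_derB u v f x : smooth f ->
  rho_der rho (addS u (oppS v)) f x = rho_der rho u f x - rho_der rho v f x.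
Proof.
move=> fs; have H := Dform_linear rho (x := x) fs.
by rewrite -[LHS]/(Dform rho f (u x - v x)) (scalar_formD H) (scalar_formN H).
Qed.

Lemma non_metricity_sym12 (P : sect E -> sect E) (g : form2 E) u v w x :
  locality_projector rho L P -> flat br L P nabla ->
  projected_torsion_free br L P nabla -> E_metric g ->
  locally_hessian rho nabla g ->
  smooth_sect u -> smooth_sect v -> smooth_sect w ->
  non_metricity rho nabla g u v w x = non_metricity rho nabla g v u w x.
Proof.
move=> [_ _ PL0 _] nflat tf gP gH us vs ws.
have [[rhos [brs _] _ _] lie] := preL.
have [U [f [oU Ux fU gE]]] := gH x.
have [F Fs Ff] := smooth_ext hausM oU Ux ((smooth_onP _ oU).1 fU).
(* Stated near [x] and not only at [x], because [derg] differentiates it. *)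
have gF a b : smooth_sect a -> smooth_sect b -> \forall z \near x,
    g z (a z) (b z) = rho_der rho a (rho_der rho b F) z - rho_der rho (nabla a b) F z.
  (* The Hessian takes two derivatives of the potential, hence the double [near_join]. *)
  move=> sa sb; have := near_join (near_join Ff).
  apply: filterS2 (open_nbhs_nbhs (conj oU Ux)) => z Uz Fz.
  have e1 : rho_der rho a (rho_der rho b f) z = rho_der rho a (rho_der rho b F) z.
    apply: near_eq_tder; apply: filterS Fz => y Fy.
    by apply: near_eq_tder; apply: filterS Fy => ? ->.
  have e2 : Dform rho f (nabla a b z) = rho_der rho (nabla a b) F z.
    by apply: near_eq_tder; have := nbhs_singleton Fz; apply: filterS => ? ->.
  have := gE a b sa sb z Uz.
  by rewrite /hessian e1 e2.
have ns := nabla_smooth nablaP.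
have ders a b : smooth_sect a -> smooth b -> smooth (rho_der rho a b).
  by move=> *; exact: smooth_rho_der.
have derg a b c : smooth_sect a -> smooth_sect b -> smooth_sect c ->
    rho_der rho a (fun y => g y (b y) (c y)) x =
    rho_der rho a (rho_der rho b (rho_der rho c F)) x
    - rho_der rho a (rho_der rho (nabla b c) F) x.
  move=> sa sb sc.
  have s1 := (smoothP _).1 (ders b _ sb (ders c F sc Fs)) x.
  have s2 := (smoothP _).1 (ders (nabla b c) F (ns _ _ sb sc) Fs) x.
  rewrite [LHS](near_eq_tder _ (gF b c sb sc)).
  by rewrite tderD//; [rewrite tderN|exact: smooth_atN].
pose m := modified_bracket br (projL P L) nabla u v.
have tfE : addS (nabla u v) (oppS (nabla v u)) = m.
  apply: functional_extensionality_dep => z; apply/eqP; rewrite -subr_eq0; apply/eqP.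
  exact: (congr1 (fun s : sect E => s z) (tf u v us vs)).
have derm h : smooth h -> rho_der rho m h x = rho_der rho (br u v) h x.
  move=> sh; rewrite /m /modified_bracket rho_derB// {2}/rho_der.
  have -> := rho_frame_trace hausM nablaP (L := projL P L) PL0 us vs x.
  rewrite -[RHS]subr0; congr (_ - _).
  exact: scalar_form0 (tder_linear ((smoothP _).1 sh x)).
have lieE h : smooth h -> rho_der rho (br u v) h x =
    rho_der rho u (rho_der rho v h) x - rho_der rho v (rho_der rho u h) x.
  by move=> sh; exact: (lie u v us vs h sh x).
have torE h : smooth h ->
    rho_der rho (nabla u v) h x - rho_der rho (nabla v u) h x =
    rho_der rho u (rho_der rho v h) x - rho_der rho v (rho_der rho u h) x.
  by move=> sh; rewrite -lieE// -derm// -tfE rho_derB.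
have flatE : addS (nabla u (nabla v w)) (oppS (nabla v (nabla u w))) = nabla m w.
  apply: functional_extensionality_dep => z; apply/eqP; rewrite -subr_eq0; apply/eqP.
  exact: (congr1 (fun s : sect E => s z) (nflat u v w us vs ws)).
have flatF : rho_der rho (nabla u (nabla v w)) F x - rho_der rho (nabla v (nabla u w)) F x
    = rho_der rho (nabla (nabla u v) w) F x - rho_der rho (nabla (nabla v u) w) F x.
  by rewrite -!rho_derB// flatE -tfE nablaBl//; exact: ns.
have g1 := nbhs_singleton (gF _ _ (ns _ _ us vs) ws).
have g2 := nbhs_singleton (gF _ _ vs (ns _ _ us ws)).
have g3 := nbhs_singleton (gF _ _ (ns _ _ vs us) ws).
have g4 := nbhs_singleton (gF _ _ us (ns _ _ vs ws)).
(* Omitting anchors, A = u(v(wF)), B = u((nabla_v w)F), C = (nabla_u v)(wF), D = (nabla_(nabla_u v)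
   w)F, N = (nabla_u nabla_v w)F; primes exchange u and v. The B terms occur on both sides; the two
   hypotheses are [torE] for wF and [flatF]. *)
have alg (A A' B B' C C' D D' N N' : R) : C - C' = A - A' -> N - N' = D - D' ->
    A - B - (C - D) - (B' - N') = A' - B' - (C' - D') - (B - N).
  by clear=> h1 h2; lra.
rewrite /non_metricity (derg u v w us vs ws) (derg v u w vs us ws) g1 g2 g3 g4.
exact: alg (torE _ (ders w F ws Fs)) flatF.
Qed.

Lemma br_linl f u v w : smooth f -> smooth_sect u -> smooth_sect v -> smooth_sect w ->
  br (addS (scaleS f u) v) w = addS (addS (addS (oppS (scaleS (rho_der rho w f) u))
     (scaleS f (br u w))) (L (Dform rho f) u w)) (br v w).
Proof.
move=> fs us vs ws; have [[_ [_ brR] _ brL] _] := preL.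
have [-> _] := R_bilinearD brR (smooth_scaleS fs us) vs ws.
by have [_ ->] := brL f u w fs us ws.
Qed.

Lemma torsion_smooth : preserves_smooth2 (torsion br L nabla).
Proof.
have [[rhos [brs _] [Ls Ll] _] _] := preL.
move=> u v us vs; apply: smooth_addS.
  by apply: smooth_addS; [|apply: smooth_oppS]; exact: (nabla_smooth nablaP).
apply: smooth_oppS; apply: smooth_addS; first exact: brs.
by apply: smooth_oppS; exact: (smooth_frame_trace hausM nablaP Ls Ll).
Qed.

(** Two defects cancel: rho(v)(f) u between nabla_v (f u) and the bracket, and L(Df, u, v) between
    the bracket and the frame contraction. *)
Lemma torsion_linl v : smooth_sect v -> Cinf_linear ((torsion br L nabla)^~ v).
Proof.
have [[rhos [brs _] [Ls Ll] _] _] := preL.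
move=> vs f u u' fs us us'; apply: functional_extensionality_dep => x.
rewrite /torsion /modified_bracket (nabla_linl nablaP)// (nabla_linr nablaP)// br_linl//.
rewrite /addS /oppS /scaleS -/(addS (scaleS f u) u').
rewrite (frame_trace_linl hausM rhos nablaP Ls Ll)//.
apply: vect_scalar_ext => phi phil.
do 12? rewrite ?(scalar_formD phil) ?(scalar_formN phil) ?(scalar_formZ phil).
ring.
Qed.

(** In the sum of the two torsions the connection terms cancel, and what is left vanishes by the
    admissibility equation. *)
Lemma torsion_anti u v : admissible br L nabla -> smooth_sect u -> smooth_sect v ->
  torsion br L nabla u v = oppS (torsion br L nabla v u).
Proof.
move=> adm us vs; apply: functional_extensionality_dep => x.
have := congr1 (fun s : sect E => s x) (adm u v us vs).
rewrite /torsion /modified_bracket /addS /oppS => admx.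
apply: vect_scalar_ext => phi phil; have := congr1 phi admx.
rewrite !((scalar_formD phil), (scalar_formN phil)).
by clear; lra.
Qed.

End Hessian.

Theorem corollary6p3 (R : realType) (n : nat) (M : manifold R n)
    (hausM : hausdorff_space M) (paraM : paracompact M) (orM : orientable M)
    (E : vbundle M) (rho : forall x : M, 'Hom(E x, tangent x))
    (br : sect E -> sect E -> sect E)
    (L : form1 E -> sect E -> sect E -> sect E)
    (hE : pre_Leibniz rho br L) (hreg : regular rho)
    (P : sect E -> sect E) (hP : locality_projector rho L P)
    (g : form2 E) (nabla : sect E -> sect E -> sect E)
    (hH : hessian_structure rho br L P g nabla)
    (hadm : admissible br L nabla) :
  statistical_structure g (non_metricity rho nabla g) (torsion br L nabla).
Proof.
have [conn nflat tf gP gH] := hH.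
have [[rhos _ _ _] _] := hE.
have anti u v : smooth_sect u -> smooth_sect v ->
    torsion br L nabla u v = oppS (torsion br L nabla v u).
  exact: (torsion_anti hadm).
split=> //.
- have [t [ts tE]] := non_metricity_form3 hausM rhos conn gP.
  exists t; split=> // x a b c.
  (* Symmetry of [t] is tested on sections through the given vectors, where [t] is the
     non-metricity. *)
  have [u us <-] := sect_ext hausM a; have [v vs <-] := sect_ext hausM b.
  have [w ws <-] := sect_ext hausM c.
  have tx u1 u2 u3 : smooth_sect u1 -> smooth_sect u2 -> smooth_sect u3 ->
      t x (u1 x) (u2 x) (u3 x) = non_metricity rho nabla g u1 u2 u3 x.
    by move=> *; rewrite tE.
  rewrite !tx//; split; first exact:
    (non_metricity_sym12 hausM hE conn _ hP nflat tf gP gH us vs ws).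
  by rewrite (non_metricity_sym23 rho nabla gP).
- exact: (torsion_smooth hausM hE conn).
- move=> v vs; split; last exact: (torsion_linl hausM hE conn vs).
  move=> f u u' fs us us'.
  (* Linearity in the second slot is transported from the first by antisymmetry. *)
  rewrite anti//; last exact: smooth_sect_lin.
  rewrite (torsion_linl hausM hE conn vs fs us us') (anti v u)// (anti v u')//.
  apply: functional_extensionality_dep => x.
  by rewrite /addS /oppS /scaleS opprD scalerN.
Qed.
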